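(* In the dynamic SBM with $0<\rho<1/2$, suppose $\lambda_n^{(l)}\to\lambda^{(l)}$ for every $l$ with $\lambda^{(1)}=\cdots=\lambda^{(L)}=:\lambda$, that $d=\min_{1\le l\le L}\frac{a^{(l)}+b^{(l)}}2\to\infty$, and that $\min_ld^{(l)}(1-d^{(l)}/n)\to\infty$. Then weak recovery is possible (every $\mathbf X^{(l)}$, $1\le l\le L$, is weakly recoverable) if $$\lambda>\frac{1-2(1-2\rho)^2\cos\theta_\ast+(1-2\rho)^4}{1-(1-2\rho)^4},$$ where $\theta_\ast\in(0,\pi)$ is the minimum solution in $(0,\pi)$ of $$0=\sin[(L+1)\theta_\ast]-2(1-2\rho)^2\sin[L\theta_\ast]+(1-2\rho)^4\sin[(L-1)\theta_\ast].$$
   Context: Dynamic SBM: fix $L\ge1$. The prior $p_{\mathsf{Dyn}}$ on $\{\pm1\}^L$ makes $(x^{(1)},\dots,x^{(L)})$ a Markov chain with $x^{(1)}$ uniform on $\{\pm1\}$ and $x^{(l)}=x^{(l-1)}$ with probability $1-\rho$, $x^{(l)}=-x^{(l-1)}$ with probability $\rho$, for $2\le l\le L$. For each $n$, $X_i$, $1\le i\le n$, are i.i.d. from $p_{\mathsf{Dyn}}$; $\mathbf X^{(l)}=(X_1^{(l)},\dots,X_n^{(l)})^\top$. Given $a^{(l)},b^{(l)}$ (which may depend on $n$), conditionally on all $X_i$ the entries $G_{i,j}^{(l)}$, $i<j$, $1\le l\le L$, are independent, $\mathrm{Bern}(a^{(l)}/n)$ if $X_i^{(l)}=X_j^{(l)}$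 and $\mathrm{Bern}(b^{(l)}/n)$ otherwise; $\mathbf G=(\mathbf G^{(1)},\dots,\mathbf G^{(L)})$. Set $d^{(l)}=\frac{a^{(l)}+b^{(l)}}2$, $\lambda_n^{(l)}=\frac{(a^{(l)}-b^{(l)})^2}{4d^{(l)}(1-d^{(l)}/n)}$. $\mathbf X^{(l)}$ is weakly recoverable if there is an estimator $\widehat{\mathbf X}^{(l)}(\mathbf G)\in\{\pm1\}^n$ with $\liminf_{n\to\infty}\mathbb E\big[\big|\frac1n\langle\widehat{\mathbf X}^{(l)},\mathbf X^{(l)}\rangle\big|\big]>0$. *)

(* Defs.v *)
From HB Require Import structures.
From mathcomp Require Import all_boot all_order all_algebra.
From mathcomp Require Import all_classical all_reals all_analysis.

Set Implicit Arguments.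
Unset Strict Implicit.
Unset Printing Implicit Defensive.

Import Order.TTheory GRing.Theory Num.Theory.
Import numFieldNormedType.Exports.

Local Open Scope classical_set_scope.
Local Open Scope ring_scope.

(* Labels in {+1, -1} are encoded by booleans, a boolean s standing for
   (-1) ^+ s; layers 1, ..., L are the ordinals 0, ..., L-1 of 'I_L. *)

Definition labels (n L : nat) : finType :=
  {ffun 'I_n -> {ffun 'I_L -> bool}}.

Definition edge (n : nat) : finType := {e : 'I_n * 'I_n | (e.1 < e.2)%N}.

Definition multigraph (n L : nat) : finType :=
  {ffun 'I_L -> {ffun edge n -> bool}}.

(* The product runs over the pairs of consecutive layers; the factor 1/2 is the
   law of the first layer, so this is a probability mass function for L >= 1. *)
Definition dyn_prior (R : realType) (L : nat) (rho : R)
    (x : {ffun 'I_L -> bool}) : R :=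
  2^-1 * \prod_(k < L) \prod_(l < L | l == k.+1 :> nat)
           (if x l == x k then 1 - rho else rho).

Definition bern (R : realType) (p : R) (g : bool) : R :=
  if g then p else 1 - p.

(* Joint law of (X, G) at size n; a and b are the layer parameters at that n. *)
Definition dyn_sbm (R : realType) (n L : nat) (rho : R) (a b : 'I_L -> R)
    (X : labels n L) (G : multigraph n L) : R :=
  (\prod_(i < n) dyn_prior rho (X i)) *
  \prod_(l < L) \prod_(e : edge n)
     bern ((if X (val e).1 l == X (val e).2 l then a l else b l) / n%:R)
          (G l e).

Definition dyn_sbm_expectation (R : realType) (n L : nat) (rho : R)
    (a b : 'I_L -> R) (f : labels n L -> multigraph n L -> R) : R :=
  \sum_(X : labels n L) \sum_(G : multigraph n L) dyn_sbm rho a b X G * f X G.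

Definition overlap (R : realType) (n L : nat) (xhat : {ffun 'I_n -> bool})
    (X : labels n L) (l : 'I_L) : R :=
  n%:R^-1 * \sum_(i < n) (-1) ^+ xhat i * (-1) ^+ X i l.

(* A deterministic estimator loses nothing: one may derandomize by fixing, for
   each graph, the best value of the external randomness. *)
Definition weakly_recoverable (R : realType) (L : nat) (rho : R)
    (a b : nat -> 'I_L -> R) (l : 'I_L) : Prop :=
  exists xhat : forall n, multigraph n L -> {ffun 'I_n -> bool},
    (0 < limn_einf (fun n : nat =>
       (dyn_sbm_expectation rho (a n) (b n)
          (fun X G => `|overlap R (xhat n G) X l|))%:E))%E.

Definition avg_degree (R : realType) (a b : R) : R := (a + b) / 2.

Definition snr (R : realType) (n : nat) (a b : R) : R :=
  (a - b) ^+ 2 / (4 * avg_degree a b * (1 - avg_degree a b / n%:R)).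

Definition layer_min (R : realType) (L : nat) (hL : (0 < L)%N)
    (f : 'I_L -> R) : R :=
  \big[Order.min/f (Ordinal hL)]_(l < L) f l.

Definition theta_equation (R : realType) (L : nat) (rho theta : R) : Prop :=
  0 = sin ((L%:R + 1) * theta)
      - 2 * (1 - 2 * rho) ^+ 2 * sin (L%:R * theta)
      + (1 - 2 * rho) ^+ 4 * sin ((L%:R - 1) * theta).

Definition is_theta_star (R : realType) (L : nat) (rho theta : R) : Prop :=
  [/\ 0 < theta < pi, theta_equation L rho theta
    & forall t : R, 0 < t < pi -> theta_equation L rho t -> theta <= t].

Definition dyn_threshold (R : realType) (rho theta : R) : R :=
  (1 - 2 * (1 - 2 * rho) ^+ 2 * cos theta + (1 - 2 * rho) ^+ 4)
  / (1 - (1 - 2 * rho) ^+ 4).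

(* Main.v *)
Require Import Defs.
From HB Require Import structures.
From mathcomp Require Import all_boot all_order all_algebra.
From mathcomp Require Import all_classical all_reals all_analysis.
From mathcomp Require Import ring lra.

Set Implicit Arguments.
Unset Strict Implicit.
Unset Printing Implicit Defensive.

Import Order.TTheory GRing.Theory Num.Theory.
Import numFieldNormedType.Exports.

Local Open Scope classical_set_scope.
Local Open Scope ring_scope.

(* Reveal the graph edge by edge. Since the degrees diverge, an edge between u
   and v in layer l is a weak binary channel about x_u x_v, and by the chain rule
   the mutual information I(X; G) is, to leading order, at least
   sum_l (lambda / 4) (n - (1 / n) sum_(u, v) E[E[x_u x_v | G]^2]). Hence, if
   I(X; G) falls short of lambda n L / 4 by a multiple of n, some layer has
   correlated posterior pairs.

   For an upper bound on I(X; G), trade the edges against independent side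
   observations of the labels with signal-to-noise ratio lambda q_l in layer l,
   each edge being shown with probability t and each side observation with
   probability 1 - t. In the derivative in t the posterior terms combine into a
   square, so that I(X; G) <= I(X; side) + n sum_l (lambda / 4) (1 - q_l)^2, and
   for small q this is
     n lambda L / 4 + (n lambda / 4) (|q|^2 - lambda q^T K q) + O(n |q|^3),
   where K_(l, m) = (1 - 2 rho)^(2 |l - m|). The Kac-Murdock-Szego matrix K has
   the eigenvalue (1 - c^2) / (1 - 2 c cos theta_* + c^2), c = (1 - 2 rho)^2,
   with a positive eigenvector, a small multiple of which is the required q.

   To pass from one layer m to every layer l, set aside two vertices i and j: the
   layer-m edges from i to the remaining vertices, weighted by the posterior
   correlations of those vertices, form a linear statistic correlated with x_i in
   layer l; doing this for i and then for j bounds E[E[x_i x_j | G]^2] from below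
   in layer l. A sample from the posterior is then a good estimator. *)

(** * The entropy of a slightly biased bit *)

(** Divergence of d(1 - d/n) makes the tilt of an edge channel small against its variance p(1 - p):
    entropies are then quadratic up to a relative error [kap], and an edge matters only through its
    strength, about lambda/n. This is why edges can be traded against fair bits. The information at
    stake is of order n, and the strengths of all edges also sum to order n, so an error quadratic
    in the total strength is affordable for one pair or one vertex, never for the whole graph; hence
    two different lower bounds on the information, and the cutting of the side information into many
    weak copies. With strengths lambda q_l the terms linear in q cancel and a quadratic form
    decides. Its matrix K contains squared correlations, since the correlation of two layers enters
    both the signal and its optimal weight. As a signal-to-noise ratio q must be nonnegative, which
    positivity of the eigenvector provides. Two vertices are set aside so that each meets its linear
    statistic with its prior law across layers. *)

Section EntropyExpansion.
Variable R : realType.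
Implicit Types p u z : R.

(** Mean value theorem: the difference vanishes at 0 and has derivative x^2/(1 + x), at most 2 z^2
    for |x| <= |z| because 1 + x >= 1/2. *)
Lemma ln1D_taylor2 z : `|z| <= 1 / 2 ->
  `|ln (1 + z) - (z - z ^+ 2 / 2)| <= 2 * `|z| ^+ 3.
Proof.
move=> hz.
have [z1 z2] : - (1/2) <= z /\ z <= 1/2 by move: hz; rewrite ler_norml => /andP[].
pose f := fun x : R => ln (1 + x) - (x - x ^+ 2 / 2).
pose df := fun x : R => x ^+ 2 / (1 + x).
have dfE (x : R) : -1 < x -> is_derive x (1:R) f (df x).
  move=> hx.
  have h1 : 0 < 1 + x by lra.
  have i1 : is_derive (1 + x : R) 1 (@ln R) (1 + x)^-1 by exact: is_derive1_ln.
  have -> : f = (@ln R \o (cst 1 + id)) - (id - (2^-1 \*: (id ^+ 2))).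
    by apply/funext => y; rewrite /f !fctE /= /GRing.scale /= [2^-1 * _]mulrC.
  have i3 : is_derive x 1 (@ln R \o (cst 1 + id)) ((1 + x)^-1 * (0 + 1)).
    exact: is_derive1_comp.
  apply: is_derive_eq.
  by rewrite /df /GRing.scale /=; field; lra.
have fb (a b : R) : a <= b -> -1 < a -> (forall x : R, x \in `]a, b[ -> is_derive x (1:R) f (df x)) /\
   {within `[a, b], continuous f}.
  move=> ab a1; split.
    by move=> x; rewrite in_itv /= => /andP[x1 x2]; apply: dfE; lra.
  apply: derivable_within_continuous => x; rewrite in_itv /= => /andP[x1 x2].
  by have := dfE x => /(_ ltac:(lra)) [].
have f0 : f 0 = 0 by rewrite /f addr0 ln1; lra.
have key c : `|c| <= `|z| -> `|df c| <= 2 * `|z| ^+ 2.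
  move=> cz.
  have c1 : - (1/2) <= c by move: (le_trans cz hz); rewrite ler_norml => /andP[].
  rewrite /df normrM ger0_norm ?sqr_ge0 // (ger0_norm (x := (1 + c)^-1)); last by rewrite invr_ge0; lra.
  rewrite ler_pdivrMr; last by lra.
  have : c ^+ 2 <= `|z| ^+ 2.
    by rewrite -(ger0_norm (sqr_ge0 c)) normrX lerXn2r ?nnegrE.
  have := sqr_ge0 `|z|.
  nra.
have fin c : `|c| <= `|z| -> f z = df c * z -> `|f z| <= 2 * `|z| ^+ 3.
  move=> cz ->; rewrite normrM (exprSr _ 2) mulrA.
  by apply: ler_wpM2r => //; exact: key.
case: (leP 0 z) => hz0.
  have [h1 h2] := fb 0 z hz0 ltac:(lra).
  have [c] := MVT_segment hz0 h1 h2.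
  rewrite in_itv /= f0 !subr0 => /andP[c0 cz] E.
  by apply: (fin c) => //; rewrite !ger0_norm.
have [h1 h2] := fb z 0 (ltW hz0) ltac:(lra).
have [c] := MVT_segment (ltW hz0) h1 h2.
rewrite in_itv /= f0 sub0r sub0r => /andP[c0 cz] E.
apply: (fin c) => //; last by move: E; rewrite mulrN => /oppr_inj.
by rewrite !ler0_norm //; lra.
Qed.

Definition eta p : R := - (p * ln p).
Definition ent p : R := eta p + eta (1 - p).

Lemma eta_taylor2 p u : 0 < p -> `|u| <= p / 2 ->
  `|eta (p + u) - (- ((p + u) * ln p) - u - u ^+ 2 / (2 * p))|
    <= 4 * (`|u| ^+ 3 / p ^+ 2).
Proof.
move=> p0 hu.
have hz : `|u / p| <= 1 / 2.
  by rewrite normrM (gtr0_norm (x := p^-1)) ?invr_gt0 // ler_pdivrMr //; lra.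
have := ln1D_taylor2 hz.
have [u1 u2] : - (p/2) <= u /\ u <= p/2 by move: hu; rewrite ler_norml => /andP[].
have E : ln (p + u) = ln p + ln (1 + u / p).
  rewrite -lnM ?posrE //; last first.
    have -> : 1 + u / p = (p + u) / p by field; lra.
    by rewrite divr_gt0 //; lra.
  by congr ln; field; lra.
set z := u / p in hz E *; set r := ln (1 + z) - _ => hr.
(* Here |r| <= 2|z|^3 and p + u <= 3p/2, hence a factor 1/2 + 3, rounded up to 4. *)
have -> : eta (p + u) - (- ((p + u) * ln p) - u - u ^+ 2 / (2 * p)) =
   p * z ^+ 3 / 2 - (p + u) * r.
  rewrite /eta E /r.
  have -> : u = p * z by rewrite /z; field; lra.
  by field; lra.
have -> : `|u| ^+ 3 / p ^+ 2 = p * `|z| ^+ 3.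
  rewrite /z normrM (gtr0_norm (x := p^-1)) ?invr_gt0 //.
  by field; lra.
apply: le_trans (ler_normB _ _) _.
rewrite (normrM (p * z ^+ 3)) (normrM p) (normrM (p + u)) normrX (gtr0_norm p0) (@ger0_norm _ 2^-1) ?invr_ge0 //.
rewrite (@ger0_norm _ (p + u)); last lra.
have := exprn_ge0 3 (normr_ge0 z).
set Z := `|z| ^+ 3 in hr * => hZ.
have : (p + u) * `|r| <= (p + p / 2) * (2 * Z) by apply: ler_pM => //; lra.
nra.
Qed.

(** Expansions at p and 1 - p: the terms -u and +u cancel, 1/p + 1/(1 - p) = 1/(p(1 - p)), and the
    cubic errors combine through p^2 + (1 - p)^2 <= 1. *)
Lemma ent_taylor2 p u : 0 < p < 1 -> `|u| <= p * (1 - p) / 2 ->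
  `|ent (p + u) - (ent p + u * (ln (1 - p) - ln p) - u ^+ 2 / (2 * (p * (1 - p))))|
    <= 4 * (`|u| ^+ 3 / (p * (1 - p)) ^+ 2).
Proof.
move=> /andP[p0 p1] hu.
have q0 : 0 < 1 - p by lra.
have h1 := eta_taylor2 p0 (u := u) ltac:(apply: le_trans hu _; nra).
have h2 := eta_taylor2 q0 (u := - u) ltac:(rewrite normrN; apply: le_trans hu _; nra).
rewrite /ent.
have E : 1 - (p + u) = 1 - p + - u by lra.
rewrite E.
move: h1 h2; rewrite normrN sqrrN => h1 h2.
set A := eta (p + u) - _ in h1.
set B := eta (1 - p + - u) - _ in h2.
have -> : eta (p + u) + eta (1 - p + - u) -
  (eta p + eta (1 - p) + u * (ln (1 - p) - ln p) - u ^+ 2 / (2 * (p * (1 - p)))) = A + B.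
  by rewrite /A /B /eta; field; lra.
apply: le_trans (ler_normD _ _) _.
apply: le_trans (lerD h1 h2) _.
have U := exprn_ge0 3 (normr_ge0 u).
set U3 := `|u| ^+ 3 in U *.
have -> : 4 * (U3 / p ^+ 2) + 4 * (U3 / (1 - p) ^+ 2) =
   4 * (U3 * (p ^+ 2 + (1 - p) ^+ 2) / (p * (1 - p)) ^+ 2) by field; lra.
rewrite ler_pM2l // ler_pM2r; last by rewrite invr_gt0 exprn_gt0 // mulr_gt0.
by rewrite ler_piMr //; nra.
Qed.

End EntropyExpansion.

(** * Weak binary channels *)

Section Channels.
Variables (R : realType) (H : finType).
Implicit Types (w f g : H -> R) (F G : (H -> R) -> R).

Record channel := Channel { bias : R; tilt : R; spin : H -> R }.

Implicit Types c : channel.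

Definition prob c x := bias c + tilt c * spin c x.
(** The signal-to-noise ratio of the channel: to second order it conveys [strength c / 2] about a
    balanced spin. *)
Definition strength c := tilt c ^+ 2 / (bias c * (1 - bias c)).
(** The tilt is small against the variance of the outcome, so the cubic term of the entropy is at
    most of order [kap] times the quadratic one. *)
Definition weak (kap : R) c :=
  [/\ 0 < bias c < 1, `|tilt c| <= kap * (bias c * (1 - bias c))
    & forall x, spin c x ^+ 2 = 1].

Definition nonneg w := forall x, 0 <= w x.
Definition mass w := \sum_x w x.
Definition lin f w := \sum_x w x * f x.
(** Homogeneous of degree one: at an unnormalised posterior, the probability of the outcomes times
    the squared posterior mean. *)
Definition post2 f w := lin f w ^+ 2 / mass w.
(** The mass of an unnormalised posterior is the probability of the outcomes, so these terms add up
    to their Shannon entropy. *)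
Definition Phi w := eta (mass w).

(* A weight [w] is an unnormalised posterior: the prior times the likelihood of
   the outcomes seen so far. [split c F] is the sum of [F] over the posteriors
   that follow the two outcomes of [c]; iterating it on [post2 f] from the prior
   yields E[E[f | outcomes]^2]. *)
Definition split c F w :=
  F (fun x => w x * prob c x) + F (fun x => w x * (1 - prob c x)).
Lemma mass_ge0 w : nonneg w -> 0 <= mass w.
Proof. by move=> w0; apply: sumr_ge0. Qed.

Lemma mass_lin w : mass w = lin (fun=> 1) w.
Proof. by apply: eq_bigr => x _; rewrite mulr1. Qed.

Lemma mass0 w : nonneg w -> mass w = 0 -> w = fun=> 0.
Proof.
move=> w0 /eqP; rewrite psumr_eq0 // => /allP h.
by apply/funext => x; apply/eqP; have := h x; rewrite mem_index_enum; apply.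
Qed.

Lemma lin_le f w b : nonneg w -> (forall x, `|f x| <= b) -> `|lin f w| <= b * mass w.
Proof.
move=> w0 fb; apply: le_trans (ler_norm_sum _ _ _) _.
rewrite mulr_sumr; apply: ler_sum => x _.
by rewrite normrM ger0_norm // mulrC ler_wpM2r.
Qed.

Lemma lin_mono f g w : nonneg w -> (forall x, f x <= g x) -> lin f w <= lin g w.
Proof. by move=> w0 fg; apply: ler_sum => x _; apply: ler_wpM2l. Qed.

Lemma linD f g w : lin (fun x => f x + g x) w = lin f w + lin g w.
Proof. by rewrite -big_split; apply: eq_bigr => x _; rewrite mulrDr. Qed.

Lemma linZ a f w : lin (fun x => a * f x) w = a * lin f w.
Proof. by rewrite mulr_sumr; apply: eq_bigr => x _; rewrite mulrCA. Qed.

Lemma linC a w : lin (fun=> a) w = a * mass w.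
Proof. by rewrite mulr_sumr; apply: eq_bigr => x _; rewrite mulrC. Qed.

Lemma lin_sum (I : Type) (r : seq I) (f : I -> H -> R) w :
  lin (fun x => \sum_(i <- r) f i x) w = \sum_(i <- r) lin (f i) w.
Proof. by rewrite exchange_big; apply: eq_bigr => x _; rewrite mulr_sumr. Qed.

Lemma lin_mul f w g : lin f (fun x => w x * g x) = lin (fun x => g x * f x) w.
Proof. by apply: eq_bigr => x _; rewrite mulrA. Qed.

Lemma lin0 f : lin f (fun=> 0) = 0.
Proof. by apply: big1 => x _; rewrite mul0r. Qed.

Lemma post2_ge0 f w : nonneg w -> 0 <= post2 f w.
Proof. by move=> w0; rewrite mulr_ge0 ?sqr_ge0 ?invr_ge0 ?mass_ge0. Qed.

(* This holds also at [w = 0], where the quotient is 0. *)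
Lemma post2_ge f w t : nonneg w -> 2 * t * lin f w - t ^+ 2 * mass w <= post2 f w.
Proof.
move=> w0; rewrite /post2; have := mass_ge0 w0.
rewrite le_eqVlt => /orP[/eqP h|m0].
  by rewrite (mass0 w0) // lin0 /mass big1 //; lra.
rewrite -subr_ge0.
have -> : lin f w ^+ 2 / mass w - (2 * t * lin f w - t ^+ 2 * mass w) =
   (lin f w - t * mass w) ^+ 2 / mass w by field; lra.
by rewrite mulr_ge0 ?sqr_ge0 // invr_ge0 ltW.
Qed.

Section Weak.
Variables (kap : R) (kap0 : 0 <= kap <= 1 / 2).

Lemma weak_spin c x : weak kap c -> `|spin c x| <= 1.
Proof.
move=> [_ _ /(_ x) h]; rewrite -(@expr_le1 _ 2) // -normrX h.
by rewrite normr1.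
Qed.

Lemma weak_tilt c : weak kap c -> `|tilt c| <= bias c * (1 - bias c) / 2.
Proof.
move=> [/andP[b0 b1] h _]; apply: (le_trans h).
have V0 : 0 <= bias c * (1 - bias c) by rewrite mulr_ge0 ?ltW ?subr_gt0.
by rewrite mulrC ler_wpM2l //; move/andP: kap0 => [_]; rewrite mul1r.
Qed.

Lemma weak_prob c m : weak kap c -> `|m| <= 1 ->
  bias c / 2 <= bias c + tilt c * m <= 1 - (1 - bias c) / 2.
Proof.
move=> hc hm; have ht := weak_tilt hc; case: hc => /andP[b0 b1] _ _.
have : `|tilt c * m| <= bias c * (1 - bias c) / 2.
  rewrite normrM; apply: le_trans ht; exact: ler_piMr.
have := sqr_ge0 (bias c); have := sqr_ge0 (1 - bias c).
set d := tilt c * m; rewrite !expr2 ler_norml => q1 q2 /andP[h1 h2].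
by apply/andP; split; lra.
Qed.

Lemma prob01 c x : weak kap c -> 0 <= prob c x <= 1.
Proof.
move=> hc; have := weak_prob hc (weak_spin x hc).
case: hc => /andP[b0 b1] _ _ /andP[h1 h2].
by rewrite /prob; apply/andP; split; lra.
Qed.

Lemma strength_ge0 c : weak kap c -> 0 <= strength c.
Proof.
by move=> [/andP[b0 b1] _ _]; rewrite /strength divr_ge0 ?sqr_ge0 // mulr_ge0; lra.
Qed.

Lemma nonneg_prob c w : weak kap c -> nonneg w -> nonneg (fun x => w x * prob c x).
Proof. by move=> hc w0 x; have /andP[h _] := prob01 x hc; rewrite mulr_ge0. Qed.

Lemma nonneg_probC c w : weak kap c -> nonneg w -> nonneg (fun x => w x * (1 - prob c x)).
Proof. by move=> hc w0 x; have /andP[_ h] := prob01 x hc; rewrite mulr_ge0 // subr_ge0. Qed.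

(** Entropy of the outcome against its mean entropy given the state. The linear terms cancel since
    [m] is the posterior mean of the spin; the quadratic ones leave d^2 (1 - m^2) / (2 V), as the
    spin squares to 1. Each of the two remainders costs 4 [kap] times the strength. *)
Lemma split_gain c w : weak kap c -> nonneg w ->
  `|split c Phi w - Phi w - lin (fun x => ent (prob c x)) w
     - strength c / 2 * (mass w - post2 (spin c) w)| <= 8 * kap * strength c * mass w.
Proof.
move=> hc w0.
have := mass_ge0 w0.
rewrite le_eqVlt => /orP[/eqP h|S0].
  rewrite (mass0 w0) // /post2 !lin0 /split /Phi.
  have mz g : mass (fun x => 0 * g x) = 0 by apply: big1 => x _; rewrite mul0r.
  have mz0 : mass (fun=> 0 : R) = 0 by exact: big1.
  by rewrite !mz mz0 /eta expr0n /= !mul0r !(oppr0, subr0, addr0, mulr0, normr0).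
set S := mass w in S0 *.
set m := lin (spin c) w / S.
have sp x := weak_spin x hc.
have m1 : `|m| <= 1.
  rewrite /m normrM (gtr0_norm (x := S^-1)) ?invr_gt0 // ler_pdivrMr //.
  exact: lin_le.
have ES : lin (spin c) w = S * m by rewrite /m; field; lra.
have E1 : mass (fun x => w x * prob c x) = S * (bias c + tilt c * m).
  rewrite mass_lin lin_mul mulrDr mulrCA -ES -linZ [S * _]mulrC -linC -linD.
  by apply: eq_bigr => x _; rewrite mulr1.
have E0 : mass (fun x => w x * (1 - prob c x)) = S * (1 - (bias c + tilt c * m)).
  rewrite mulrBr mulr1 -E1 /S /mass -sumrB.
  by apply: eq_bigr => x _; rewrite mulrBr mulr1.
have /andP[p1 p2] := weak_prob hc m1.
have ht := weak_tilt hc.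
have hk : `|tilt c| <= kap * (bias c * (1 - bias c)) by case: hc.
have ss x : spin c x ^+ 2 = 1 by case: hc.
case: (hc) => /andP[b0 b1] _ _.
have etaM y : 0 < y -> eta (S * y) = - (S * y * ln S) + S * eta y.
  by move=> y0; rewrite /eta lnM ?posrE //; ring.
have -> : split c Phi w - Phi w = S * ent (bias c + tilt c * m).
  rewrite /split /Phi E1 E0 !etaM ?/ent; try lra.
  by rewrite -/S /eta; ring.
rewrite /strength.
set V := bias c * (1 - bias c) in hk ht *.
have V0 : 0 < V by rewrite mulr_gt0 // subr_gt0.
pose A := ent (bias c); pose B := ln (1 - bias c) - ln (bias c).
pose r (u : R) := ent (bias c + u) - (A + u * B - u ^+ 2 / (2 * V)).
have rb u : `|u| <= `|tilt c| -> `|r u| <= 4 * (kap * (tilt c ^+ 2 / V)).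
  move=> hu; apply: le_trans (ent_taylor2 _ (le_trans hu ht)) _; first by rewrite b0.
  rewrite ler_pM2l // -/V ler_pdivrMr ?exprn_gt0 //.
  have -> : kap * (tilt c ^+ 2 / V) * V ^+ 2 = (kap * V) * `|tilt c| ^+ 2.
    by rewrite real_normK ?num_real //; field; lra.
  apply: le_trans (_ : `|tilt c| ^+ 3 <= _); first by rewrite lerXn2r ?nnegrE.
  by rewrite exprS ler_wpM2r ?sqr_ge0.
have -> : lin (fun x => ent (prob c x)) w =
   S * A + B * tilt c * (S * m) - S * (tilt c ^+ 2 / (2 * V))
   + lin (fun x => r (tilt c * spin c x)) w.
  rewrite -ES -linZ [S * A]mulrC [S * (tilt c ^+ 2 / _)]mulrC -mulNr -!linC -!linD.
  apply: eq_bigr => x _; congr (_ * _).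
  by rewrite /r /prob exprMn ss; ring.
have -> : post2 (spin c) w = S * m ^+ 2 by rewrite /post2 ES -/S; field; lra.
have -> : ent (bias c + tilt c * m) = A + tilt c * m * B - (tilt c * m) ^+ 2 / (2 * V) + r (tilt c * m).
  by rewrite /r; ring.
set L := lin _ w.
have Lb : `|L| <= 4 * (kap * (tilt c ^+ 2 / V)) * S.
  apply: lin_le => // x; apply: rb.
  by rewrite normrM ler_piMr.
have rm : `|r (tilt c * m)| <= 4 * (kap * (tilt c ^+ 2 / V)).
  by apply: rb; rewrite normrM ler_piMr.
have -> : S * (A + tilt c * m * B - (tilt c * m) ^+ 2 / (2 * V) + r (tilt c * m)) -
 (S * A + B * tilt c * (S * m) - S * (tilt c ^+ 2 / (2 * V)) + L) -
 tilt c ^+ 2 / V / 2 * (S - S * m ^+ 2) = S * r (tilt c * m) - L by field; lra.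
apply: le_trans (ler_normB _ _) _.
rewrite normrM (gtr0_norm S0).
have : S * `|r (tilt c * m)| <= S * (4 * (kap * (tilt c ^+ 2 / V))) by rewrite ler_pM2l.
lra.
Qed.

End Weak.
End Channels.

Section Split.
Variables (R : realType) (H : finType).
Implicit Types (w f g : H -> R) (F G : (H -> R) -> R) (c : channel R H).

(** Outcomes are conditionally independent given the state, so their order is irrelevant. *)
Lemma splitC c d F : split c (split d F) = split d (split c F).
Proof.
apply/funext => w; rewrite /split.
have E g h : (fun x => w x * g x * h x) = (fun x => w x * h x * g x).
  by apply/funext => x; rewrite mulrAC.
rewrite (E (prob c)) (E (prob c) (fun x => 1 - prob d x)).
rewrite (E (fun x => 1 - prob c x) (prob d)) (E (fun x => 1 - prob c x)).
ring.
Qed.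

Lemma split_lin c f w : split c (lin f) w = lin f w.
Proof. by rewrite /split !lin_mul -linD; apply: eq_bigr => x _; ring. Qed.

Lemma split_mass c w : split c (@mass R H) w = mass w.
Proof. by rewrite mass_lin -(split_lin c) /split !mass_lin. Qed.

Lemma split_comb (J : Type) (r : seq J) (a : J -> R) (Fs : J -> (H -> R) -> R) b c w :
  split c (fun w => \sum_(j <- r) a j * (mass w - Fs j w) + b * mass w) w
  = \sum_(j <- r) a j * (mass w - split c (Fs j) w) + b * mass w.
Proof.
rewrite -(split_mass c w) /split addrACA -mulrDr -big_split /=; congr (_ + _).
by apply: eq_bigr => j _; ring.
Qed.

Variables (kap : R) (kap0 : 0 <= kap <= 1 / 2).

Lemma split_mono c F G w : weak kap c -> (forall w, nonneg w -> F w <= G w) ->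
  nonneg w -> split c F w <= split c G w.
Proof.
move=> hc FG w0; apply: lerD; apply: FG.
  exact: (nonneg_prob kap0 hc w0).
exact: (nonneg_probC kap0 hc w0).
Qed.

(** Jensen: both children are tested with the posterior mean of the parent. *)
Lemma post2_le_split c f w : weak kap c -> nonneg w -> post2 f w <= split c (post2 f) w.
Proof.
move=> hc w0; have := mass_ge0 w0; rewrite le_eqVlt => /orP[/eqP h|S0].
  rewrite {1}/post2 -h invr0 mulr0; apply: addr_ge0; apply: post2_ge0.
    exact: (nonneg_prob kap0 hc w0).
  exact: (nonneg_probC kap0 hc w0).
pose t := lin f w / mass w.
apply: le_trans (lerD (post2_ge f t (nonneg_prob kap0 hc w0)) (post2_ge f t (nonneg_probC kap0 hc w0))).
set A1 := lin f _; set M1 := mass _; set A0 := lin f _; set M0 := mass _.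
have hA : A1 + A0 = lin f w by exact: (split_lin c f w).
have hM : M1 + M0 = mass w by exact: (split_mass c w).
rewrite le_eqVlt; apply/orP; left; apply/eqP.
transitivity (2 * t * (A1 + A0) - t ^+ 2 * (M1 + M0)); last ring.
by rewrite hA hM /t /post2; field; lra.
Qed.

(** The gain is exactly d^2 (B - A m)^2 / (S y (1 - y)), where B - A m is an unnormalised posterior
    covariance of [f] and the spin. Now |B - A m| <= 2 S gives a factor 4, and y (1 - y) >= p (1 -
    p) / 4 another. *)
Lemma split_le_post2 c f w : weak kap c -> nonneg w -> (forall x, `|f x| <= 1) ->
  split c (post2 f) w <= post2 f w + 16 * strength c * mass w.
Proof.
move=> hc w0 f1; have := mass_ge0 w0; rewrite le_eqVlt => /orP[/eqP h|S0].
  rewrite (mass0 w0) // /split /post2 -!/(mass _) !lin_mul.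
  by rewrite !lin0 expr0n /= !mul0r /mass big1 // !mulr0 !addr0.
set S := mass w in S0 *; set A := lin f w.
pose m := lin (spin c) w / S.
pose B := lin (fun x => spin c x * f x) w.
have sp x := weak_spin x hc.
have m1 : `|m| <= 1.
  rewrite /m normrM (gtr0_norm (x := S^-1)) ?invr_gt0 // ler_pdivrMr //.
  exact: lin_le.
have A1 : `|A| <= S by rewrite -[S]mul1r; exact: lin_le.
have B1 : `|B| <= S.
  rewrite -[S]mul1r; apply: lin_le => // x; rewrite normrM.
  by rewrite mulr_ile1.
have ES : lin (spin c) w = S * m by rewrite /m; field; lra.
have EP1 : mass (fun x => w x * prob c x) = S * (bias c + tilt c * m).
  rewrite mass_lin lin_mul mulrDr mulrCA -ES -linZ [S * _]mulrC -linC -linD.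
  by apply: eq_bigr => x _; rewrite mulr1.
have EP0 : mass (fun x => w x * (1 - prob c x)) = S * (1 - (bias c + tilt c * m)).
  by rewrite mulrBr mulr1 -EP1 -[S](split_mass c) /split; ring.
have EA1 : lin f (fun x => w x * prob c x) = bias c * A + tilt c * B.
  by rewrite lin_mul -!linZ -linD; apply: eq_bigr => x _; rewrite /prob; ring.
have EA0 : lin f (fun x => w x * (1 - prob c x)) = (1 - bias c) * A - tilt c * B.
  apply: (addrI (lin f (fun x => w x * prob c x))).
  rewrite [LHS](split_lin c) EA1 -/A; ring.
rewrite /split /post2 EP1 EP0 EA1 EA0 -/A -/S /strength.
have /andP[] := weak_prob kap0 hc m1.
set p := bias c; set d := tilt c; set y := p + d * m => y1 y2.
have /andP[p0 p1] : 0 < p < 1 by case: hc.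
have y0 : 0 < y by lra.
have y01 : 0 < 1 - y by lra.
have -> : (p * A + d * B) ^+ 2 / (S * y) + ((1 - p) * A - d * B) ^+ 2 / (S * (1 - y)) =
  A ^+ 2 / S + d ^+ 2 * (B - A * m) ^+ 2 / (S * (y * (1 - y))).
  have Ed : d * m = y - p by rewrite /y; ring.
  have -> : d ^+ 2 * (B - A * m) ^+ 2 = (d * B - A * (d * m)) ^+ 2 by ring.
  by rewrite Ed; field; lra.
rewrite lerD2l ler_pdivrMr; last by rewrite !mulr_gt0.
have hB : (B - A * m) ^+ 2 <= (2 * S) ^+ 2.
  rewrite -[X in X <= _]ger0_norm ?sqr_ge0 // normrX.
  apply: lerXn2r; rewrite ?nnegrE //; first lra.
  apply: le_trans (ler_normB _ _) _; rewrite normrM.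
  have : `|A| * `|m| <= S by apply: le_trans A1; exact: ler_piMr.
  lra.
have V0 : 0 < p * (1 - p) by rewrite mulr_gt0 ?subr_gt0.
have yy : p * (1 - p) / 4 <= y * (1 - y).
  have := ler_pM (_ : 0 <= p / 2) (_ : 0 <= (1 - p) / 2) y1 (_ : (1 - p) / 2 <= 1 - y).
  by move=> h; have := h ltac:(lra) ltac:(lra) ltac:(lra); lra.
have d0 := sqr_ge0 d.
apply: le_trans (_ : d ^+ 2 * (2 * S) ^+ 2 <= _); first exact: ler_wpM2l.
have -> : 16 * (d ^+ 2 / (p * (1 - p))) * S * (S * (y * (1 - y))) =
   16 * d ^+ 2 * S ^+ 2 / (p * (1 - p)) * (y * (1 - y)) by ring.
have -> : d ^+ 2 * (2 * S) ^+ 2 = 16 * d ^+ 2 * S ^+ 2 / (p * (1 - p)) * (p * (1 - p) / 4).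
  by field; lra.
apply: ler_wpM2l => //; apply: divr_ge0; last exact: ltW.
by apply: mulr_ge0; rewrite ?sqr_ge0 // mulr_ge0.
Qed.

End Split.

(** * Chain rule and monotonicity for lists of channels *)

Section Observation.
Variables (R : realType) (H : finType) (I : eqType) (ch : I -> channel R H).
Implicit Types (w f g : H -> R) (F G : (H -> R) -> R) (s : seq I).

(** A repeated index stands for independent repetitions of the channel; the side observations rely
    on this. *)
Definition obs s F := foldr (fun i => split (ch i)) F s.
Definition total s := \sum_(i <- s) strength (ch i).
Definition noise s w := \sum_(i <- s) lin (fun x => ent (prob (ch i) x)) w.
(* Mutual information between the hidden state, distributed as [w], and the
   outcomes: their entropy minus their conditional entropy [noise]. *)
Definition info s w := obs s (@Phi R H) w - Phi w - noise s w.

Lemma obs_cat s1 s2 F : obs (s1 ++ s2) F = obs s1 (obs s2 F).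
Proof. exact: foldr_cat. Qed.

Lemma obs_split i s F : obs s (split (ch i) F) = split (ch i) (obs s F).
Proof. by elim: s => //= j s ->; rewrite splitC. Qed.

Lemma obsC s1 s2 F : obs s1 (obs s2 F) = obs s2 (obs s1 F).
Proof. by elim: s1 => //= i s ->; rewrite obs_split. Qed.

Lemma obs_perm s1 s2 F : perm_eq s1 s2 -> obs s1 F = obs s2 F.
Proof.
elim: s1 s2 => [|i s1 ih] s2; first by rewrite perm_sym => /perm_nilP ->.
move=> h; have : i \in s2 by rewrite -(perm_mem h) mem_head.
move=> /splitPr hs; case: hs h => s3 s4.
rewrite -(cat1s i s4) perm_sym perm_catCA /= perm_cons perm_sym => h.
by rewrite (ih _ h) !obs_cat /= obs_split.
Qed.

Lemma obs_lin s f : obs s (lin f) = lin f.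
Proof. by elim: s => //= i s ->; apply/funext => w; exact: split_lin. Qed.

Lemma obs_mass s : obs s (@mass R H) = @mass R H.
Proof. by elim: s => //= i s ->; apply/funext => w; exact: split_mass. Qed.

Lemma noise_lin s w : noise s w = lin (fun x => \sum_(i <- s) ent (prob (ch i) x)) w.
Proof. by rewrite lin_sum. Qed.

Lemma noise_cat s1 s2 w : noise (s1 ++ s2) w = noise s1 w + noise s2 w.
Proof. exact: big_cat. Qed.

(** Chain rule for mutual information: [noise] is linear in the weight, hence unchanged on average
    when [ch i] is revealed. *)
Lemma info_cons i s w : info (i :: s) w =
  (split (ch i) (@Phi R H) w - Phi w - lin (fun x => ent (prob (ch i) x)) w)
  + split (ch i) (info s) w.
Proof.
have E : split (ch i) (noise s) w = noise s w.
  have -> : noise s = lin (fun x => \sum_(i <- s) ent (prob (ch i) x)).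
    by apply/funext => v; exact: noise_lin.
  exact: split_lin.
have -> : split (ch i) (info s) w =
    split (ch i) (obs s (@Phi R H)) w - split (ch i) (@Phi R H) w - noise s w.
  by rewrite -E /split /info; ring.
by rewrite /info /noise big_cons -/(noise s w) [obs (i :: s) _]/=; ring.
Qed.

Lemma obs_sub s F G w : obs s (fun w => F w - G w) w = obs s F w - obs s G w.
Proof.
elim: s w => //= i s ih w.
have -> : obs s (fun w => F w - G w) = fun w => obs s F w - obs s G w.
  exact/funext.
rewrite /split; ring.
Qed.

Lemma obsD s F G w : obs s (fun w => F w + G w) w = obs s F w + obs s G w.
Proof.
elim: s w => //= i s ih w.
have -> : obs s (fun w => F w + G w) = fun w => obs s F w + obs s G w.
  exact/funext.
rewrite /split; ring.
Qed.

Lemma info_cat s1 s2 w : info (s1 ++ s2) w = info s1 w + obs s1 (info s2) w.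
Proof.
have E : obs s1 (noise s2) w = noise s2 w.
  have -> : noise s2 = lin (fun x => \sum_(i <- s2) ent (prob (ch i) x)).
    by apply/funext => v; exact: noise_lin.
  by rewrite obs_lin.
by rewrite /info noise_cat obs_cat !obs_sub E; ring.
Qed.

Variables (kap : R) (kap0 : 0 <= kap <= 1 / 2) (hch : forall i, weak kap (ch i)).

Lemma total_ge0 s : 0 <= total s.
Proof. by apply: sumr_ge0 => i _; apply: strength_ge0 (hch i). Qed.

Lemma obs_mono s F G w : (forall w, nonneg w -> F w <= G w) ->
  nonneg w -> obs s F w <= obs s G w.
Proof.
move=> FG; elim: s w => [|i s ih] w w0; first exact: FG.
exact: (split_mono kap0 (hch i)).
Qed.

Lemma post2_le_obs s f w : nonneg w -> post2 f w <= obs s (post2 f) w.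
Proof.
elim: s w => //= i s ih w w0.
apply: le_trans (post2_le_split kap0 f (hch i) w0) _.
exact: (split_mono kap0 (hch i)).
Qed.

Lemma obs_le_catr s1 s2 f w : nonneg w -> obs s1 (post2 f) w <= obs (s1 ++ s2) (post2 f) w.
Proof. by move=> w0; rewrite obs_cat; apply: obs_mono => // v; exact: post2_le_obs. Qed.

Lemma obs_le_catl s1 s2 f w : nonneg w -> obs s2 (post2 f) w <= obs (s1 ++ s2) (post2 f) w.
Proof. by rewrite obs_cat obsC -obs_cat; exact: obs_le_catr. Qed.

Lemma obs_le_subset s1 s2 f w : nonneg w -> uniq s1 -> uniq s2 -> {subset s1 <= s2} ->
  obs s1 (post2 f) w <= obs s2 (post2 f) w.
Proof.
move=> w0 u1 u2 s12.
have h : perm_eq s2 (s1 ++ [seq i <- s2 | i \notin s1]).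
  rewrite perm_sym; apply: perm_trans (permEl (perm_filterC (mem s1) s2)).
  rewrite perm_cat2r; apply: uniq_perm => //; first exact: filter_uniq.
  by move=> i; rewrite mem_filter inE; case: (boolP (i \in s1)) => //= /s12.
by rewrite (obs_perm _ h); exact: obs_le_catr.
Qed.

Lemma obs_le_post2 s f w : nonneg w -> (forall x, `|f x| <= 1) ->
  obs s (post2 f) w <= post2 f w + 16 * total s * mass w.
Proof.
move=> w0 f1; elim: s w w0 => [|i s ih] w w0.
  by rewrite /total big_nil mulr0 mul0r addr0.
rewrite /total big_cons -/(total s) /=.
apply: le_trans (split_mono kap0 (hch i) ih w0) _.
have := split_le_post2 kap0 (hch i) w0 f1.
rewrite -[mass w](split_mass (ch i)) /split; lra.
Qed.

(** Subadditivity: earlier outcomes can only raise squared posterior means, so each channel is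
    charged as if it came first. *)
Lemma info_le s w : nonneg w ->
  info s w <= \sum_(i <- s) strength (ch i) / 2 * (mass w - post2 (spin (ch i)) w)
              + 8 * kap * total s * mass w.
Proof.
elim: s w => [|i s ih] w w0.
  by rewrite /info /noise /total !big_nil /= subrr subr0 mulr0 mul0r addr0.
rewrite info_cons /total !big_cons -/(total s).
have := split_gain kap0 (hch i) w0; rewrite ler_norml => /andP[_ h1].
have h2 := split_mono kap0 (hch i) ih w0.
rewrite split_comb in h2.
have h3 : \sum_(j <- s) strength (ch j) / 2 * (mass w - split (ch i) (post2 (spin (ch j))) w)
    <= \sum_(j <- s) strength (ch j) / 2 * (mass w - post2 (spin (ch j)) w).
  apply: ler_sum => j _; apply: ler_wpM2l; first by apply: divr_ge0 => //; exact: strength_ge0 (hch j).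
  by rewrite lerD2l lerN2; apply: (post2_le_split kap0 _ (hch i)).
lra.
Qed.

(** Each earlier channel raises a squared posterior mean by at most 16 times its strength; the cross
    terms make up the quadratic error, which is small only for lists of small total strength. *)
Lemma info_ge s w : nonneg w ->
  \sum_(i <- s) strength (ch i) / 2 * (mass w - post2 (spin (ch i)) w)
     - (8 * kap * total s + 8 * total s ^+ 2) * mass w <= info s w.
Proof.
elim: s w => [|i s ih] w w0.
  by rewrite /info /noise /total !big_nil /= subrr subr0; lra.
rewrite info_cons /total !big_cons -/(total s).
have := split_gain kap0 (hch i) w0; rewrite ler_norml => /andP[h1 _].
have {}ih v : nonneg v -> \sum_(i <- s) strength (ch i) / 2 * (mass v - post2 (spin (ch i)) v)
     + - (8 * kap * total s + 8 * total s ^+ 2) * mass v <= info s v.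
  by move=> v0; have := ih v v0; lra.
have h2 := split_mono kap0 (hch i) ih w0.
rewrite split_comb in h2.
have h3 : \sum_(j <- s) strength (ch j) / 2 * (mass w - post2 (spin (ch j)) w)
     - \sum_(j <- s) strength (ch j) * (8 * strength (ch i) * mass w) <=
  \sum_(j <- s) strength (ch j) / 2 * (mass w - split (ch i) (post2 (spin (ch j))) w).
  rewrite -sumrB; apply: ler_sum => j _.
  have := split_le_post2 kap0 (hch i) w0 (fun x => weak_spin x (hch j)).
  have := strength_ge0 (hch j).
  set a := strength (ch j); set b := strength (ch i); set M := mass w => a0 h.
  have := ler_wpM2l (_ : 0 <= a / 2) h.
  move=> /(_ ltac:(lra)); lra.
rewrite -mulr_suml -/(total s) in h3.
have T0 := total_ge0 s.
have S0 := strength_ge0 (hch i).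
have M0 := mass_ge0 w0.
set T := total s in h2 h3 T0 *; set a := strength (ch i) in h1 h3 S0 *; set M := mass w in h1 h2 h3 M0 *.
have : 0 <= a * T * M by apply: mulr_ge0 => //; exact: mulr_ge0.
have : 0 <= a ^+ 2 * M by apply: mulr_ge0 => //; exact: sqr_ge0.
lra.
Qed.

(** Here each channel counts as if it came last, which by monotonicity only lowers its contribution.
    There is no quadratic error, so the bound serves for the whole graph. *)
Lemma info_ge_obs s w : nonneg w ->
  \sum_(i <- s) strength (ch i) / 2 * (mass w - obs s (post2 (spin (ch i))) w)
     - 8 * kap * total s * mass w <= info s w.
Proof.
elim: s w => [|i s ih] w w0.
  by rewrite /info /noise /total !big_nil /= subrr subr0; lra.
rewrite info_cons /total !big_cons -/(total s).
have := split_gain kap0 (hch i) w0; rewrite ler_norml => /andP[h1 _].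
have {}ih v : nonneg v -> \sum_(i <- s) strength (ch i) / 2 * (mass v - obs s (post2 (spin (ch i))) v)
     + - (8 * kap * total s) * mass v <= info s v.
  by move=> v0; have := ih v v0; lra.
have h2 := split_mono kap0 (hch i) ih w0.
rewrite split_comb in h2.
have := post2_le_obs (i :: s) (spin (ch i)) w0.
have S0 := strength_ge0 (hch i).
rewrite /=; set a := strength (ch i) in h1 S0 *; set M := mass w in h1 h2 *.
move=> h; have := ler_wpM2l (_ : 0 <= a / 2) h.
move=> /(_ ltac:(lra)); lra.
Qed.

End Observation.

(** * Interpolation between two sets of observations *)

Section Interpolation.
Variables (R : realType) (H : finType) (I : eqType) (ch : I -> channel R H).
Variables (kap : R) (kap0 : 0 <= kap <= 1 / 2) (hch : forall i, weak kap (ch i)).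
Local Notation obs := (obs ch).
Implicit Types (w f g : H -> R) (F G : (H -> R) -> R) (e : seq I * seq I).

(* At time [t] the pair of observation lists [e] shows [e.1] with probability
   [t] and [e.2] otherwise. *)
Definition mix (t : R) e F w := t * obs e.1 F w + (1 - t) * obs e.2 F w.
Definition mixs (t : R) (ops : seq (seq I * seq I)) F := foldr (mix t) F ops.
Fixpoint dmixs (t : R) (ops : seq (seq I * seq I)) F w :=
  if ops is e :: es then
    obs e.1 (mixs t es F) w - obs e.2 (mixs t es F) w + mix t e (dmixs t es F) w
  else 0.

Lemma obs_derive s (G : R -> (H -> R) -> R) (dG : (H -> R) -> R) (t : R) w :
  (forall w, is_derive t 1 (G ^~ w) (dG w)) ->
  is_derive t 1 (fun u => obs s (G u) w) (obs s dG w).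
Proof.
move=> hG; elim: s w => [|i s ih] w /=; first exact: hG.
exact: is_deriveD.
Qed.

Lemma mixs_derive ops F (t : R) w :
  is_derive t 1 (fun u => mixs u ops F w) (dmixs t ops F w).
Proof.
elim: ops w => [|e es ih] w /=; first exact: is_derive_cst.
have h1 := obs_derive e.1 w ih.
have h2 := obs_derive e.2 w ih.
have -> : (fun u => mix u e (mixs u es F) w) =
  (id * (fun u => obs e.1 (mixs u es F) w)) +
  ((cst 1 - id) * (fun u => obs e.2 (mixs u es F) w)).
  by apply/funext => u; rewrite /mix.
apply: is_derive_eq.
by rewrite /mix /GRing.scale /= !fctE /=; ring.
Qed.

Lemma mixs_obs t ops s F : mixs t ops (obs s F) = obs s (mixs t ops F).
Proof.
elim: ops => //= e es ->; apply/funext => w.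
rewrite /mix !(obsC _ _ s) -[LHS]/(_ + _).
elim: s w => //= i s ih w.
by rewrite /split -!ih; ring.
Qed.

Lemma mixs_sub t ops F G w :
  mixs t ops (fun w => F w - G w) w = mixs t ops F w - mixs t ops G w.
Proof.
elim: ops w => //= e es ih w.
have -> : mixs t es (fun w => F w - G w) = fun w => mixs t es F w - mixs t es G w.
  exact/funext.
by rewrite /mix !obs_sub; ring.
Qed.

Lemma mix_lin t e f : mix t e (lin f) = lin f.
Proof. by apply/funext => w; rewrite /mix !obs_lin; ring. Qed.

Lemma mixs_lin t ops f : mixs t ops (lin f) = lin f.
Proof. by elim: ops => //= e es ->; rewrite mix_lin. Qed.

Lemma mix_mono t e F G w : 0 <= t <= 1 -> (forall w, nonneg w -> F w <= G w) ->
  nonneg w -> mix t e F w <= mix t e G w.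
Proof.
move=> /andP[t0 t1] FG w0; apply: lerD; apply: ler_wpM2l; rewrite ?subr_ge0 //;
  exact: (obs_mono kap0 hch).
Qed.

Lemma mixs_mono t ops F G w : 0 <= t <= 1 -> (forall w, nonneg w -> F w <= G w) ->
  nonneg w -> mixs t ops F w <= mixs t ops G w.
Proof.
move=> ht FG; elim: ops w => [|e es ih] w w0; first exact: FG.
exact: mix_mono.
Qed.

Lemma mixs_mix t ops e F : mixs t ops (mix t e F) = mix t e (mixs t ops F).
Proof.
have E (es : seq (seq I * seq I)) G1 G2 w : mixs t es (fun w => t * G1 w + (1 - t) * G2 w) w =
    t * mixs t es G1 w + (1 - t) * mixs t es G2 w.
  elim: es w => //= e' es ih w.
  have -> : mixs t es (fun w => t * G1 w + (1 - t) * G2 w) =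
     fun w => t * mixs t es G1 w + (1 - t) * mixs t es G2 w by exact/funext.
  have O s K1 K2 v : obs s (fun w => t * K1 w + (1 - t) * K2 w) v =
      t * obs s K1 v + (1 - t) * obs s K2 v.
    elim: s v => //= i s ihs v.
    have -> : obs s (fun w => t * K1 w + (1 - t) * K2 w) =
       fun w => t * obs s K1 w + (1 - t) * obs s K2 w by exact/funext.
    by rewrite /split; ring.
  by rewrite /mix !O; ring.
by apply/funext => w; rewrite /mix E !mixs_obs.
Qed.

Lemma mixsD t ops F G w :
  mixs t ops (fun w => F w + G w) w = mixs t ops F w + mixs t ops G w.
Proof.
have -> : (fun w => F w + G w) = (fun w => F w - (0 - G w)).
  by apply/funext => v; ring.
rewrite !mixs_sub.
have -> : mixs t ops (fun=> 0) w = 0.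
  transitivity (mixs t ops (fun w => F w - F w) w); last by rewrite mixs_sub subrr.
  by congr (mixs _ _ _ _); apply/funext => v; rewrite subrr.
ring.
Qed.

(** The derivative term of entry [e] is averaged over a mixture from which [e] is absent. Passing
    from [b] to [b'] puts [e] back, so that all terms stand under one mixture and their sum can be
    bounded for each posterior separately. *)
Lemma dmixs_le t ops F w (b b' : seq I * seq I -> (H -> R) -> R) : 0 <= t <= 1 ->
  (forall e w, e \in ops -> nonneg w -> obs e.1 F w - obs e.2 F w <= b e w) ->
  (forall e w, e \in ops -> nonneg w -> b e w <= mix t e (b' e) w) ->
  nonneg w -> dmixs t ops F w <= mixs t ops (fun w => \sum_(e <- ops) b' e w) w.
Proof.
move=> ht; elim: ops w => [|e es ih] w hb hb' w0 /=; first by rewrite big_nil.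
have -> : (fun v => \sum_(j <- e :: es) b' j v) =
   (fun v => b' e v + \sum_(j <- es) b' j v).
  by apply/funext => v; rewrite big_cons.
rewrite -mixs_mix.
have -> : mix t e (fun v => b' e v + \sum_(j <- es) b' j v) =
  (fun v => mix t e (b' e) v + mix t e (fun v => \sum_(j <- es) b' j v) v).
  by apply/funext => v; exact: (mixsD t [:: e]).
rewrite mixsD; apply: lerD.
  rewrite -!mixs_obs -mixs_sub; apply: mixs_mono => // v v0.
  by apply: le_trans (hb _ _ (mem_head _ _) v0) _; apply: hb'; rewrite ?mem_head.
rewrite mixs_mix; apply: mix_mono => // v v0.
apply: ih => // j u hj u0; [apply: hb | apply: hb'] => //; by rewrite inE hj orbT.
Qed.

Lemma mixs1 ops F : mixs 1 ops F = obs (flatten [seq e.1 | e <- ops]) F.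
Proof.
elim: ops => //= e es ->; rewrite obs_cat; apply/funext => w.
by rewrite /mix; ring.
Qed.

Lemma mixs0 ops F : mixs 0 ops F = obs (flatten [seq e.2 | e <- ops]) F.
Proof.
elim: ops => //= e es ->; rewrite obs_cat; apply/funext => w.
by rewrite /mix; ring.
Qed.

(** Mean value theorem on [0, 1]; the bound is a [lin g] because linear functionals are invariant
    under every mixture. *)
Lemma interpolation ops F g w (b b' : seq I * seq I -> (H -> R) -> R) :
  (forall e w, e \in ops -> nonneg w -> obs e.1 F w - obs e.2 F w <= b e w) ->
  (forall t e w, 0 <= t <= 1 -> e \in ops -> nonneg w -> b e w <= mix t e (b' e) w) ->
  (forall w, nonneg w -> \sum_(e <- ops) b' e w <= lin g w) ->
  nonneg w ->
  obs (flatten [seq e.1 | e <- ops]) F w - obs (flatten [seq e.2 | e <- ops]) F w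
    <= lin g w.
Proof.
move=> hb hb' hg w0; rewrite -mixs1 -mixs0.
have [|c] := @MVT_segment R (fun u => mixs u ops F w) (fun t => dmixs t ops F w) 0 1 ler01
  (fun t _ => mixs_derive ops F t w).
  by apply: derivable_within_continuous => t _; have [] := mixs_derive ops F t w.
rewrite in_itv /= => hc ->; rewrite subr0 mulr1.
apply: le_trans (dmixs_le hc hb (fun e v => hb' c e v hc) w0) _.
by rewrite -(mixs_lin c ops g); apply: mixs_mono.
Qed.

End Interpolation.

(** * Linear statistics and pairs of posterior samples *)

Section Statistics.
Variables (R : realType) (H : finType).
Implicit Types (w f g : H -> R).

Section Linear.
Variables (I : eqType) (ch : I -> channel R H).
Variables (kap : R) (kap0 : 0 <= kap <= 1 / 2) (hch : forall i, weak kap (ch i)).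

(* By [post2_ge], it is enough to test [f] against the statistic that sums, over
   [s], [a i] times the centered outcome of channel [i], scaled so that its
   conditional mean is [strength (ch i) * spin (ch i)]. *)
Lemma obs_ge_linear s (a : I -> R) f w : nonneg w ->
  lin (fun x => 2 * f x * (\sum_(i <- s) a i * strength (ch i) * spin (ch i) x)
       - (\sum_(i <- s) a i * strength (ch i) * spin (ch i) x) ^+ 2
       - (1 + kap) * \sum_(i <- s) a i ^+ 2 * strength (ch i)) w
  <= obs ch s (post2 f) w.
Proof.
(* The offset [t] carries the value that the statistic has accumulated so far. *)
suff gen t v : nonneg v ->
  lin (fun x => 2 * f x * (t + \sum_(i <- s) a i * strength (ch i) * spin (ch i) x)
       - (t + \sum_(i <- s) a i * strength (ch i) * spin (ch i) x) ^+ 2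
       - (1 + kap) * \sum_(i <- s) a i ^+ 2 * strength (ch i)) v
  <= obs ch s (post2 f) v.
  move=> w0; apply: le_trans (gen 0 w w0).
  by apply: lin_mono => // x; rewrite !add0r.
elim: s t v => [|i s ih] t v v0.
  apply: le_trans (post2_ge f t v0).
  have -> : 2 * t * lin f v - t ^+ 2 * mass v = lin (fun x => 2 * t * f x + - t ^+ 2) v.
    by rewrite linD linZ linC mulNr.
  rewrite le_eqVlt; apply/orP; left; apply/eqP.
  by apply: eq_bigr => x _; rewrite !big_nil; ring.
rewrite /= /split.
have hi := hch i.
have /andP[p0 p1] : 0 < bias (ch i) < 1 by case: hi.
have hk : `|tilt (ch i)| <= kap * (bias (ch i) * (1 - bias (ch i))) by case: hi.
set p := bias (ch i) in p0 p1 hk; set d := tilt (ch i) in hk.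
set V := p * (1 - p) in hk.
have V0 : 0 < V by rewrite mulr_gt0 // subr_gt0.
pose t1 := t + a i * (1 - p) * d / V.
pose t0 := t - a i * p * d / V.
apply: le_trans (lerD (ih t1 _ (nonneg_prob kap0 hi v0)) (ih t0 _ (nonneg_probC kap0 hi v0))).
rewrite !lin_mul -linD; apply: lin_mono => // x.
rewrite !big_cons /prob /strength -/p -/d -/V.
set sp := spin (ch i) x.
set m := \sum_(j <- s) _; set u := \sum_(j <- s) _; set al := a i.
have s1 : sp ^+ 2 = 1 by case: (hi) => _ _; exact.
have sp1 : `|sp| <= 1 by exact: (weak_spin x hi).
(* Given the state, the second moment of the outcome about p is V + (1 - 2p) d s; this excess is the
   source of the factor 1 + [kap]. *)
have k1 : (1 - 2 * p) * (d * sp) / V <= kap.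
  rewrite ler_pdivrMr //; apply: le_trans (ler_norm _) _.
  rewrite !normrM; apply: le_trans hk.
  have p2 : `|1 - 2 * p| <= 1 by rewrite ler_norml; lra.
  by rewrite -[X in _ <= X]mul1r ler_pM // ler_piMr.
have a2 : 0 <= al ^+ 2 * (d ^+ 2 / V) by rewrite mulr_ge0 ?sqr_ge0 // divr_ge0 ?sqr_ge0 // ltW.
have h := ler_wpM2l a2 k1.
have h2 : 0 <= (al * (d ^+ 2 / V)) ^+ 2 * sp ^+ 2 by rewrite mulr_ge0 ?sqr_ge0.
rewrite -subr_ge0.
set X := (X in 0 <= X).
have -> : X = (al * (d ^+ 2 / V)) ^+ 2 * sp ^+ 2 +
   (al ^+ 2 * (d ^+ 2 / V) * kap - al ^+ 2 * (d ^+ 2 / V) * ((1 - 2 * p) * (d * sp) / V)).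
  rewrite /X /t1 /t0 /V -/al; field; lra.
lra.
Qed.

End Linear.

Lemma lin_sqr g w : lin g w ^+ 2 = \sum_x \sum_y w x * w y * (g x * g y).
Proof.
rewrite expr2 /lin mulr_suml; apply: eq_bigr => x _.
by rewrite mulr_sumr; apply: eq_bigr => y _; ring.
Qed.

Lemma sum_lin_sqr (J : Type) (r : seq J) (f : J -> H -> R) w :
  \sum_(i <- r) lin (f i) w ^+ 2 =
  \sum_x \sum_y w x * w y * \sum_(i <- r) f i x * f i y.
Proof.
under eq_bigr => i _ do rewrite lin_sqr.
rewrite exchange_big; apply: eq_bigr => x _.
by rewrite exchange_big; apply: eq_bigr => y _; rewrite mulr_sumr.
Qed.

Lemma replica_sum (J : Type) (r : seq J) (f : J -> H -> R) w :
  \sum_(i <- r) \sum_(j <- r) lin (fun x => f i x * f j x) w ^+ 2 =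
  \sum_x \sum_y w x * w y * (\sum_(i <- r) f i x * f i y) ^+ 2.
Proof.
under eq_bigr => i _ do rewrite sum_lin_sqr.
rewrite exchange_big; apply: eq_bigr => x _.
rewrite exchange_big; apply: eq_bigr => y _.
rewrite -mulr_sumr; congr (_ * _).
rewrite expr2 mulr_suml; apply: eq_bigr => i _.
by rewrite mulr_sumr; apply: eq_bigr => j _; ring.
Qed.

(** For independent posterior samples x and y, this is the mass times the mean of (o - q |r|)^2,
    where o is the sum of the f_i(x) f_i(y). *)
Lemma replica_square (J : Type) (r : seq J) (f : J -> H -> R) (q : R) w : nonneg w ->
  0 <= \sum_(i <- r) \sum_(j <- r) post2 (fun x => f i x * f j x) w
       - 2 * (q * (size r)%:R) * \sum_(i <- r) post2 (f i) w
       + (q * (size r)%:R) ^+ 2 * mass w.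
Proof.
move=> w0; have := mass_ge0 w0; rewrite le_eqVlt => /orP[/eqP h|S0].
  rewrite -h mulr0 addr0 /post2 -h invr0.
  rewrite big1; last by move=> i _; rewrite big1 // => j _; rewrite mulr0.
  by rewrite big1 ?mulr0 ?subr0 // => i _; rewrite mulr0.
set c := q * _.
have -> : \sum_(i <- r) \sum_(j <- r) post2 (fun x => f i x * f j x) w
       - 2 * c * \sum_(i <- r) post2 (f i) w + c ^+ 2 * mass w =
  (\sum_x \sum_y w x * w y * (\sum_(i <- r) f i x * f i y - c) ^+ 2) / mass w.
  have E : \sum_x \sum_y w x * w y * (\sum_(i <- r) f i x * f i y - c) ^+ 2 =
     \sum_(i <- r) \sum_(j <- r) lin (fun x => f i x * f j x) w ^+ 2
     - 2 * c * \sum_(i <- r) lin (f i) w ^+ 2 + c ^+ 2 * mass w ^+ 2.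
    rewrite replica_sum sum_lin_sqr [mass w]mass_lin lin_sqr !mulr_sumr -sumrB -big_split.
    apply: eq_bigr => x _ /=; rewrite !mulr_sumr -sumrB -big_split.
    by apply: eq_bigr => y _ /=; ring.
  have D (K : Type) (g : K -> H -> R) (s : seq K) :
      (\sum_(i <- s) lin (g i) w ^+ 2) / mass w = \sum_(i <- s) post2 (g i) w.
    by rewrite mulr_suml.
  rewrite E [RHS]mulrDl [X in _ = X + _]mulrBl -[X in _ = _ - X + _]mulrA D mulr_suml.
  congr (_ - _ + _); last by field; lra.
  by apply: eq_bigr => i _; rewrite D.
apply: mulr_ge0; last by rewrite invr_ge0 ltW.
by apply: sumr_ge0 => x _; apply: sumr_ge0 => y _; apply: mulr_ge0; [exact: mulr_ge0 | exact: sqr_ge0].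
Qed.

End Statistics.

(** * The Markov chain prior *)

Section Chain.
Variables (R : realType) (L : nat) (rho : R).
Hypothesis hrho : 0 < rho < 1 / 2.
Let r : R := 1 - 2 * rho.
Implicit Types z : {ffun 'I_L -> bool}.

Definition sgn (b : bool) : R := (-1) ^+ b.

Definition step (k : 'I_L) z : R :=
  \prod_(l < L | l == k.+1 :> nat) (if z l == z k then 1 - rho else rho).

(** Reverses the transition out of [k] and preserves all others, so it isolates that transition in
    sums over chains. *)
Definition flip_after (k : 'I_L) z : {ffun 'I_L -> bool} :=
  [ffun l => z l (+) (k < l)%N].

Lemma flip_afterK k : involutive (flip_after k).
Proof. by move=> z; apply/ffunP => l; rewrite !ffunE addbK. Qed.

Lemma sgn2 b : sgn b ^+ 2 = 1.
Proof. by case: b; rewrite /sgn ?expr1 ?expr0 ?sqrrN expr1n. Qed.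

Lemma sgn_norm b : `|sgn b| <= 1.
Proof. by rewrite /sgn normrX normrN normr1 expr1n. Qed.

Lemma step_flip j k z : j != k -> step j (flip_after k z) = step j z.
Proof.
move=> jk; apply: eq_bigr => l /eqP hl; rewrite !ffunE hl ltnS.
have -> : (k <= j)%N = (k < j)%N by rewrite [RHS]ltn_neqAle eq_sym (inj_eq (@ord_inj L)) jk.
by rewrite (inj_eq (@addIb _)).
Qed.

Lemma stepE (k l : 'I_L) z : l = k.+1 :> nat ->
  step k z = 2^-1 + r / 2 * (sgn (z k) * sgn (z l)).
Proof.
move=> hl; rewrite /step (big_pred1 l); last first.
  by move=> j; rewrite -hl.
by rewrite /r /sgn; case: (z l); case: (z k) => /=; rewrite ?expr1 ?expr0; lra.
Qed.

Lemma sgn_flip (k l : 'I_L) z : l = k.+1 :> nat ->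
  sgn (flip_after k z k) * sgn (flip_after k z l) = - (sgn (z k) * sgn (z l)).
Proof.
move=> hl; rewrite !ffunE hl ltnn leqnn /sgn.
by case: (z l); case: (z k) => /=; rewrite ?expr1 ?expr0; ring.
Qed.

Lemma sum_odd (k l : 'I_L) (B : {ffun 'I_L -> bool} -> R) : l = k.+1 :> nat ->
  (forall z, B (flip_after k z) = B z) ->
  \sum_z B z * (sgn (z k) * sgn (z l)) = 0.
Proof.
move=> hl hB; set S := \sum_z _.
suff : S = - S by lra.
rewrite {1}/S (reindex_inj (inv_inj (flip_afterK k))) -sumrN.
by apply: eq_bigr => z _; rewrite hB sgn_flip // mulrN.
Qed.

Lemma sum_step (k l : 'I_L) (B : {ffun 'I_L -> bool} -> R) : l = k.+1 :> nat ->
  (forall z, B (flip_after k z) = B z) ->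
  \sum_z step k z * B z = 2^-1 * \sum_z B z.
Proof.
move=> hl hB; have h0 := sum_odd hl hB.
transitivity (\sum_z (2^-1 * B z + r / 2 * (B z * (sgn (z k) * sgn (z l))))).
  by apply: eq_bigr => z _; rewrite (stepE _ hl); ring.
by rewrite big_split -!mulr_sumr /= h0 mulr0 addr0.
Qed.

Lemma sum_step_sgn (k l : 'I_L) (B : {ffun 'I_L -> bool} -> R) : l = k.+1 :> nat ->
  (forall z, B (flip_after k z) = B z) ->
  \sum_z step k z * B z * (sgn (z k) * sgn (z l)) = r / 2 * \sum_z B z.
Proof.
move=> hl hB; have h0 := sum_odd hl hB.
transitivity (\sum_z (r / 2 * B z + 2^-1 * (B z * (sgn (z k) * sgn (z l))))).
  apply: eq_bigr => z _; rewrite (stepE _ hl).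
  have E : sgn (z k) ^+ 2 * sgn (z l) ^+ 2 = 1 by rewrite !sgn2 mulr1.
  transitivity (r / 2 * B z * (sgn (z k) ^+ 2 * sgn (z l) ^+ 2) + 2^-1 * (B z * (sgn (z k) * sgn (z l)))).
    ring.
  by rewrite E mulr1.
by rewrite big_split -!mulr_sumr /= h0 mulr0 addr0.
Qed.

Lemma dyn_priorE z : dyn_prior rho z = 2^-1 * \prod_(k < L) step k z.
Proof. by []. Qed.

Lemma dyn_prior_ge0 z : 0 <= dyn_prior rho z.
Proof.
rewrite /dyn_prior mulr_ge0 ?invr_ge0 //; apply: prodr_ge0 => k _; apply: prodr_ge0 => l _.
by move/andP: hrho => [h1 h2]; case: ifP => _; lra.
Qed.

Lemma dyn_prior_sum : (0 < L)%N -> \sum_(z : {ffun 'I_L -> bool}) dyn_prior rho z = 1.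
Proof.
move=> hL.
have key m : (m < L)%N -> \sum_(z : {ffun 'I_L -> bool}) \prod_(k < L | (k < m)%N) step k z = 2 ^+ L * 2^-1 ^+ m.
  elim: m => [|m ih] hm.
    rewrite (eq_bigr (fun=> 1)); last by move=> z _; rewrite big_pred0.
    by rewrite sumr_const card_ffun card_bool card_ord expr0 mulr1 -natrX.
  have hm' : (m < L)%N by exact: ltnW.
  pose k := Ordinal hm'; pose l := Ordinal hm.
  rewrite exprS mulrCA -(ih hm') -(@sum_step k l) //.
    apply: eq_bigr => z _; rewrite (bigD1 k) /=; last exact: ltnSn.
    congr (_ * _); apply: eq_bigl => j.
    by rewrite ltnS [RHS]ltn_neqAle andbC.
  move=> z; apply: eq_bigr => j jk; apply: step_flip.
  by apply: contraTneq jk => ->; rewrite ltnn.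
have hL1 : (L.-1 < L)%N by rewrite prednK.
(* The last layer has no successor, so its [step] is an empty product. *)
rewrite -mulr_sumr (eq_bigr (fun z => \prod_(k < L | (k < L.-1)%N) step k z)); last first.
  move=> z _; rewrite (bigID (fun k : 'I_L => (k < L.-1)%N)) /= [X in _ * X]big1 ?mulr1 //.
  move=> k hk; rewrite /step big_pred0 // => l; apply/negP => /eqP E.
  have := ltn_ord l; rewrite E; move: hk; rewrite -leqNgt => hk.
  by rewrite -[X in (_ < X)%N](prednK hL) ltnS ltnNge hk.
rewrite (key _ hL1) mulrCA -exprS prednK // -exprMn divff ?expr1n //.
Qed.

(** One of the truncated differences vanishes, so the exponent is |l - m|. *)
Definition corr (l m : 'I_L) : R := r ^+ (l - m + (m - l)).

Lemma corr_ge0 l m : 0 <= corr l m.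
Proof. by rewrite exprn_ge0 // /r; move/andP: hrho => [h1 h2]; lra. Qed.

Lemma corr_le1 l m : corr l m <= 1.
Proof. by rewrite exprn_ile1 // /r; move/andP: hrho => [h1 h2]; lra. Qed.

(** Induction on the distance: the last transition multiplies the correlation by 1 - 2 rho, and the
    square of the intermediate sign can be inserted freely. *)
Lemma dyn_prior_corr (l m : 'I_L) :
  \sum_z dyn_prior rho z * (sgn (z l) * sgn (z m)) = corr l m.
Proof.
have hL : (0 < L)%N by apply: leq_ltn_trans (ltn_ord l).
have key d (j k : 'I_L) : k = (j + d)%N :> nat ->
    \sum_z dyn_prior rho z * (sgn (z j) * sgn (z k)) = r ^+ d.
  elim: d k => [|d ih] k hk.
    have -> : k = j by apply: ord_inj; rewrite hk addn0.
    rewrite expr0 -(dyn_prior_sum hL); apply: eq_bigr => z _.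
    by rewrite -expr2 sgn2 mulr1.
  have hk' : (j + d < L)%N by have := ltn_ord k; rewrite hk addnS => /ltnW.
  pose k' := Ordinal hk'.
  have kk : k = k'.+1 :> nat by rewrite hk addnS.
  pose B z := (2^-1 * \prod_(i < L | i != k') step i z) * (sgn (z j) * sgn (z k')).
  have pE z : dyn_prior rho z * (sgn (z j) * sgn (z k')) = step k' z * B z.
    by rewrite dyn_priorE (bigD1 k') //= /B; ring.
  have hB z : B (flip_after k' z) = B z.
    rewrite /B; congr (_ * _ * _); first by apply: eq_bigr => i hi; exact: step_flip.
    by rewrite !ffunE ltnn [(k' < j)%N]ltnNge leq_addr !addbF.
  rewrite exprS -(ih k') // (eq_bigr _ (fun z _ => pE z)) (sum_step kk hB).
  rewrite mulrA -(sum_step_sgn kk hB); apply: eq_bigr => z _.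
  rewrite -pE; have := sgn2 (z k') => h.
  transitivity (dyn_prior rho z * (sgn (z j) * sgn (z k)) * sgn (z k') ^+ 2); last ring.
  by rewrite h mulr1.
case: (leqP l m) => [lm|/ltnW lm].
  by rewrite (key (m - l)%N) ?subnKC // /corr (eqP lm).
rewrite /corr (eqP lm) addn0 -(key (l - m)%N m l) ?subnKC //.
by apply: eq_bigr => z _; rewrite [sgn (z m) * _]mulrC.
Qed.

End Chain.

(** * Independence of the vertices under the prior *)

Section Sites.
Variables (R : realType) (n L : nat) (rho : R).
Hypotheses (hrho : 0 < rho < 1 / 2) (hL : (0 < L)%N).
Implicit Types (x : labels n L) (z : {ffun 'I_L -> bool}).

Definition prior x : R := \prod_(i < n) dyn_prior rho (x i).
Definition sigma (i : 'I_n) (l : 'I_L) x : R := sgn R (x i l).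

Definition update (i : 'I_n) x z : labels n L := [ffun j => if j == i then z else x j].
Definition free (i : 'I_n) (F : labels n L -> R) := forall x z, F (update i x z) = F x.

Lemma prior_ge0 : nonneg prior.
Proof. by move=> x; apply: prodr_ge0 => i _; exact: dyn_prior_ge0. Qed.

(** Resampling: row [i] and an independent chain [z] are exchangeable, and swapping them is an
    involution. *)
Lemma prior_swap i (K : labels n L -> {ffun 'I_L -> bool} -> R) :
  \sum_x \sum_z prior x * dyn_prior rho z * K x z =
  \sum_x \sum_z prior x * dyn_prior rho z * K (update i x z) (x i).
Proof.
rewrite !pair_big /=.
pose s (u : labels n L * {ffun 'I_L -> bool}) := (update i u.1 u.2, u.1 i).
have sK : involutive s.
  move=> [x z]; rewrite /s /=; congr pair; last by rewrite ffunE eqxx.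
  by apply/ffunP => j; rewrite !ffunE; case: eqP => // ->.
rewrite (reindex_inj (inv_inj sK)) /=; apply: eq_bigr => -[x z] _ /=.
congr (_ * _); rewrite /prior (bigD1 i) //= [in RHS](bigD1 i) //= ffunE eqxx.
rewrite (eq_bigr (fun j => dyn_prior rho (x j))); first by ring.
by move=> j ji; rewrite ffunE (negbTE ji).
Qed.

Lemma prior_indep i (h : {ffun 'I_L -> bool} -> R) (F : labels n L -> R) : free i F ->
  lin (fun x => h (x i) * F x) prior = (\sum_z dyn_prior rho z * h z) * lin F prior.
Proof.
move=> hF; rewrite /lin.
transitivity (\sum_x \sum_(z : {ffun 'I_L -> bool}) prior x * dyn_prior rho z * (h (x i) * F x)).
  by apply: eq_bigr => x _; rewrite -mulr_suml -mulr_sumr dyn_prior_sum // mulr1.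
etransitivity; first exact: (prior_swap i (fun x _ => h (x i) * F x)).
rewrite mulr_sumr; apply: eq_bigr => x _.
rewrite mulr_suml; apply: eq_bigr => z _.
by rewrite hF ffunE eqxx; ring.
Qed.

Lemma mass_prior : mass prior = 1.
Proof.
rewrite /mass /prior -(bigA_distr_bigA (fun (i : 'I_n) z => dyn_prior rho z)).
by rewrite big1 // => i _; exact: dyn_prior_sum.
Qed.

Lemma prior_corr i l m (F : labels n L -> R) : free i F ->
  lin (fun x => sigma i l x * sigma i m x * F x) prior = corr rho l m * lin F prior.
Proof.
move=> hF; rewrite -dyn_prior_corr.
exact: (@prior_indep i (fun z => sgn R (z l) * sgn R (z m)) F hF).
Qed.

Lemma sigma2 i l x : sigma i l x ^+ 2 = 1.
Proof. exact: sgn2. Qed.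

Lemma sigma_norm i l x : `|sigma i l x| <= 1.
Proof. exact: sgn_norm. Qed.

Lemma sigma_free i j l : j != i -> free i (sigma j l).
Proof. by move=> ji x z; rewrite /sigma ffunE (negbTE ji). Qed.

End Sites.

(** * Interpolation of mutual information *)

Section InfoInterpolation.
Variables (R : realType) (H : finType) (I : eqType) (ch : I -> channel R H).
Variables (kap : R) (kap0 : 0 <= kap <= 1 / 2) (hch : forall i, weak kap (ch i)).
Local Notation obs := (obs ch).
Implicit Types (w f g : H -> R) (F G : (H -> R) -> R) (s : seq I).

(* The leading term of [info s w] for weak channels, see [info_le] and [info_ge]. *)
Definition gain s w :=
  \sum_(i <- s) strength (ch i) / 2 * (mass w - post2 (spin (ch i)) w).

Lemma obs_comb s r1 r2 g w :
  obs s (fun w => gain r1 w - gain r2 w + lin g w) w =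
  \sum_(i <- r1) strength (ch i) / 2 * (mass w - obs s (post2 (spin (ch i))) w)
  - \sum_(i <- r2) strength (ch i) / 2 * (mass w - obs s (post2 (spin (ch i))) w)
  + lin g w.
Proof.
elim: s w => //= i s ih w.
have -> : obs s (fun w => gain r1 w - gain r2 w + lin g w) = fun w =>
  \sum_(i <- r1) strength (ch i) / 2 * (mass w - obs s (post2 (spin (ch i))) w)
  - \sum_(i <- r2) strength (ch i) / 2 * (mass w - obs s (post2 (spin (ch i))) w)
  + lin g w by exact/funext.
have S r : \sum_(j <- r) strength (ch j) / 2 * (mass w - split (ch i) (obs s (post2 (spin (ch j)))) w) =
   split (ch i) (fun w => \sum_(j <- r) strength (ch j) / 2 * (mass w - obs s (post2 (spin (ch j))) w)) w.
  have := split_comb r (fun j => strength (ch j) / 2) (fun j => obs s (post2 (spin (ch j)))) 0 (ch i) w.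
  by rewrite mul0r addr0 => <-; rewrite /split !mul0r !addr0.
by rewrite !S -[lin g w](split_lin (ch i)) /split; ring.
Qed.

(** The error is quadratic in the strengths of single entries only. With about N^2 entries of
    strength of order 1/N it sums to order N [kap] + 1, against information of order N. *)
Lemma info_interpolation (ops : seq (seq I * seq I)) (B : R) w :
  (forall w, nonneg w ->
     \sum_(e <- ops) (gain e.1 w - gain e.2 w) <= B * mass w) ->
  nonneg w ->
  info ch (flatten [seq e.1 | e <- ops]) w - info ch (flatten [seq e.2 | e <- ops]) w
  <= (B + \sum_(e <- ops) 8 * (total ch e.1 + total ch e.2) * (kap + (total ch e.1 + total ch e.2))) * mass w.
Proof.
move=> hB w0.
pose G (e : seq I * seq I) x := \sum_(i <- e.1) ent (prob (ch i) x) - \sum_(i <- e.2) ent (prob (ch i) x).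
have GE e v : lin (G e) v = noise ch e.1 v - noise ch e.2 v.
  by rewrite !noise_lin -mulN1r -linZ -linD; apply: eq_bigr => x _; rewrite /G mulN1r.
pose er1 (e : seq I * seq I) := 8 * kap * (total ch e.1 + total ch e.2) + 8 * total ch e.2 ^+ 2.
pose er (e : seq I * seq I) := 8 * (total ch e.1 + total ch e.2) * (kap + (total ch e.1 + total ch e.2)).
pose b e v := gain e.1 v - gain e.2 v + lin (fun x => G e x + er1 e) v.
pose b' e v := gain e.1 v - gain e.2 v + lin (fun x => G e x + er e) v.
have hb e v : e \in ops -> nonneg v -> obs e.1 (@Phi R H) v - obs e.2 (@Phi R H) v <= b e v.
  move=> _ v0; have := info_le kap0 hch e.1 v0; have := info_ge kap0 hch e.2 v0.
  rewrite /b /gain linD linC GE /er1 /info; lra.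
have hb' t e v : 0 <= t <= 1 -> e \in ops -> nonneg v -> b e v <= mix ch t e (b' e) v.
  move=> /andP[t0 t1] _ v0; rewrite /mix /b' !obs_comb.
  set Z := lin _ v.
  have up s i : obs s (post2 (spin (ch i))) v <= post2 (spin (ch i)) v + 16 * total ch s * mass v.
    by apply: (obs_le_post2 kap0 hch) => // x; exact: (weak_spin x (hch i)).
  have lo s i : post2 (spin (ch i)) v <= obs s (post2 (spin (ch i))) v.
    exact: (post2_le_obs kap0 hch).
  have M0 := mass_ge0 v0.
  have th i : 0 <= strength (ch i) / 2 by rewrite divr_ge0 ?(strength_ge0 (hch i)).
  (* Restoring an entry raises squared posterior means by 16 times its total, which costs the first
     gain 8 times a product of totals; the subtracted gain only decreases ([D]), which is
     favourable. *)
  have A s : gain e.1 v - 8 * total ch s * total ch e.1 * mass v <=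
      \sum_(i <- e.1) strength (ch i) / 2 * (mass v - obs s (post2 (spin (ch i))) v).
    rewrite {2}/total [X in _ - X * _]mulr_sumr mulr_suml /gain -sumrB.
    by apply: ler_sum => i _; have := ler_wpM2l (th i) (up s i); lra.
  have D s : \sum_(i <- e.2) strength (ch i) / 2 * (mass v - obs s (post2 (spin (ch i))) v) <= gain e.2 v.
    by apply: ler_sum => i _; apply: ler_wpM2l => //; rewrite lerD2l lerN2.
  have T1 := total_ge0 hch e.1; have T2 := total_ge0 hch e.2.
  have := A e.1; have := A e.2; have := D e.1; have := D e.2.
  set a11 := \sum_(i <- e.1) _; set a12 := \sum_(i <- e.1) _.
  set a21 := \sum_(i <- e.2) _; set a22 := \sum_(i <- e.2) _.
  move=> d2 d1 a2 a1.
  have m1 : gain e.1 v - 8 * (total ch e.1 + total ch e.2) * total ch e.1 * mass v <= a12.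
    apply: le_trans a1.
    suff : 0 <= total ch e.2 * total ch e.1 * mass v by lra.
    by rewrite !mulr_ge0.
  have m2 : gain e.1 v - 8 * (total ch e.1 + total ch e.2) * total ch e.1 * mass v <= a11.
    apply: le_trans a2.
    suff : 0 <= total ch e.1 * total ch e.1 * mass v by lra.
    by rewrite !mulr_ge0.
  have t1' : 0 <= 1 - t by rewrite subr_ge0.
  have c1 := ler_wpM2l t0 (lerB m1 d1).
  have c2 := ler_wpM2l t1' (lerB m2 d2).
  rewrite /b /Z !linD !linC /er1 /er.
  suff : 0 <= total ch e.1 * total ch e.2 * mass v by lra.
  by rewrite !mulr_ge0.
pose g x := \sum_(e <- ops) G e x + (B + \sum_(e <- ops) er e).
have hg v : nonneg v -> \sum_(e <- ops) b' e v <= lin g v.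
  move=> v0; rewrite /g linD lin_sum linC mulrDl.
  have := hB v v0.
  have -> : \sum_(e <- ops) b' e v = \sum_(e <- ops) (gain e.1 v - gain e.2 v)
     + \sum_(e <- ops) lin (G e) v + (\sum_(e <- ops) er e) * mass v.
    rewrite mulr_suml -!big_split; apply: eq_bigr => e _ /=.
    by rewrite /b' linD linC addrA.
  lra.
have := interpolation kap0 hch hb hb' hg w0.
have nf (pr : seq I * seq I -> seq I) : noise ch (flatten [seq pr e | e <- ops]) w = \sum_(e <- ops) noise ch (pr e) w.
  elim: ops {hB hb hb' g hg} => [|e es ih] /=; first by rewrite /noise !big_nil.
  by rewrite noise_cat ih big_cons.
rewrite /info !nf /g linD lin_sum linC.
have -> : \sum_(e <- ops) lin (G e) w = \sum_(e <- ops) noise ch e.1 w - \sum_(e <- ops) noise ch e.2 w.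
  by rewrite -sumrB; apply: eq_bigr => e _; exact: GE.
lra.
Qed.

End InfoInterpolation.

(** * Overlaps in some layer *)

Section SBM.
Variables (R : realType) (n L : nat) (rho : R).
Hypotheses (hrho : 0 < rho < 1 / 2) (hL : (0 < L)%N).

(* [inl (i, j, l)] is the edge indicator of the pair [{i, j}] in layer [l],
   [inr (i, l)] a side observation of the label of [i] in layer [l]. *)
Definition code : eqType := (('I_n * 'I_n * 'I_L) + ('I_n * 'I_L))%type.

Variables (p d side : 'I_L -> R).

Definition ch (c : code) : channel R (labels n L) :=
  match c with
  | inl (i, j, l) => Channel (p l) (d l) (fun x => sigma R i l x * sigma R j l x)
  | inr (i, l) => Channel 2^-1 (side l) (sigma R i l)
  end.

Variable kap : R.
Hypothesis kap0 : 0 <= kap <= 1 / 2.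
Hypothesis hp : forall l, 0 < p l < 1.
Hypothesis hd : forall l, `|d l| <= kap * (p l * (1 - p l)).
Hypothesis hside : forall l, `|side l| <= kap / 4.

Lemma weak_ch c : weak kap (ch c).
Proof.
case: c => [[[i j] l]|[i l]]; split => //=.
- by move=> x; rewrite exprMn !sigma2 mulr1.
- by apply/andP; split; lra.
- by have := hside l; lra.
- by move=> x; exact: sigma2.
Qed.

Definition esnr l := d l ^+ 2 / (p l * (1 - p l)).
Definition ssnr l := side l ^+ 2 / (2^-1 * (1 - 2^-1)).
Local Notation pi0 := (@prior R n L rho).
Local Notation obs := (obs ch).

Lemma esnr_ge0 l : 0 <= esnr l.
Proof.
have /andP[h1 h2] := hp l.
by rewrite /esnr divr_ge0 ?sqr_ge0 // mulr_ge0; lra.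
Qed.

Lemma ssnr_ge0 l : 0 <= ssnr l.
Proof. by rewrite /ssnr divr_ge0 ?sqr_ge0 //; lra. Qed.

Definition pairs (U : seq 'I_n) :=
  [seq (i, j) | i : 'I_n <- U, j : 'I_n <- [seq k : 'I_n <- U | (i < k)%N]].
Definition star (u : 'I_n * 'I_n) : seq code := [seq inl (u, l) | l <- enum 'I_L].
Definition block (i : 'I_n) : seq code := [seq inr (i, l) | l <- enum 'I_L].
Definition edges U := flatten [seq star u | u <- pairs U].
Definition sides (N : nat) U := flatten [seq flatten (nseq N (block i)) | i <- U].

Lemma big_pairs U (g : 'I_n -> 'I_n -> R) :
  (forall i j, g i j = g j i) -> (forall i, g i i = 0) ->
  \sum_(u <- pairs U) g u.1 u.2 = 2^-1 * \sum_(i <- U) \sum_(j <- U) g i j.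
Proof.
move=> gC g0; rewrite big_allpairs_dep /=.
under eq_bigr => i _ do rewrite big_filter.
set S := \sum_(i <- U) _.
have S' : \sum_(i <- U) \sum_(j <- U | (j < i)%N) g i j = S.
  rewrite (exchange_big_dep predT) //=; apply: eq_bigr => i _.
  by apply: eq_bigr => j _.
suff -> : \sum_(i <- U) \sum_(j <- U) g i j = S + S by lra.
rewrite -{2}S' -big_split; apply: eq_bigr => i _ /=.
rewrite (bigID (fun j : 'I_n => (i < j)%N)) /=; congr (_ + _).
rewrite (bigID (fun j : 'I_n => (j < i)%N)) /= [X in _ + X]big1 ?addr0.
  by apply: eq_bigl => j; rewrite -leqNgt; case: ltngtP.
move=> j; rewrite -!leqNgt => h; have -> : j = i by apply: ord_inj; apply/eqP; rewrite eqn_leq.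
exact: g0.
Qed.

Lemma sum_const_seq (J : Type) (r : seq J) (a : R) : \sum_(i <- r) a = (size r)%:R * a.
Proof. by rewrite big_const_seq count_predT iter_addr_0 mulr_natl. Qed.

Lemma size_pairs U : (size (pairs U))%:R <= (size U)%:R ^+ 2 :> R.
Proof.
rewrite -natrX ler_nat size_allpairs_dep -mulnn.
suff h (V W : seq 'I_n) :
    (sumn [seq size [seq k : 'I_n <- W | (i < k)%N] | i : 'I_n <- V] <= size V * size W)%N by exact: h.
elim: V => //= i V ih; rewrite mulSn; apply: leq_add => //.
by rewrite size_filter; exact: count_size.
Qed.

Lemma big_star u (F : code -> R) : \sum_(c <- star u) F c = \sum_l F (inl (u, l)).
Proof. by rewrite big_map big_enum. Qed.

Lemma big_block i (F : code -> R) : \sum_(c <- block i) F c = \sum_l F (inr (i, l)).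
Proof. by rewrite big_map big_enum. Qed.

Lemma total_star u : total ch (star u) = \sum_l esnr l.
Proof. by rewrite /total big_star; case: u. Qed.

Lemma total_block i : total ch (block i) = \sum_l ssnr l.
Proof. by rewrite /total big_block. Qed.

Lemma post2_diag (i : 'I_n) (l : 'I_L) w : post2 (fun x => sigma R i l x * sigma R i l x) w = mass w.
Proof.
have -> : (fun x : labels n L => sigma R i l x * sigma R i l x) = fun=> 1.
  by apply/funext => x; rewrite -expr2 sigma2.
rewrite /post2 -mass_lin; have [->|h] := eqVneq (mass w) 0; first by rewrite expr0n /= mul0r.
by rewrite expr2 mulfK.
Qed.

(** Half of [replica_square]: completing the square removes the unknown overlaps from the bound. *)
Lemma pairs_gain U (l : 'I_L) (q : R) w : nonneg w ->
  \sum_(u <- pairs U) (mass w - post2 (fun x => sigma R u.1 l x * sigma R u.2 l x) w)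
  - (size U)%:R * (q * \sum_(i <- U) (mass w - post2 (sigma R i l) w))
  <= 2^-1 * (size U)%:R ^+ 2 * (1 - q) ^+ 2 * mass w.
Proof.
move=> w0; rewrite (big_pairs U (g := fun i j => mass w - post2 (fun x => sigma R i l x * sigma R j l x) w)).
- have := replica_square U (fun i => sigma R i l) q w0.
  under [X in _ -> _ * X - _ <= _]eq_bigr => i _ do rewrite sumrB.
  rewrite !sumrB !sum_const_seq.
  set A := \sum_(i <- U) _; set B := \sum_(i <- U) _; set N := size U; set M := mass w.
  lra.
- by move=> i j; congr (_ - post2 _ _); apply/funext => x; rewrite mulrC.
- by move=> i; rewrite post2_diag subrr.
Qed.

(** A pair exchanges its edges in all layers for nothing; each vertex gains its block through |U|
    separate entries, so that every entry has strength of order 1/|U|. *)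
Definition ops U := [seq (star u, [::] : seq code) | u <- pairs U]
  ++ flatten [seq nseq (size U) ([::] : seq code, block i) | i <- U].

Lemma flatten_nil (T : Type) (J : Type) (s : seq J) : flatten [seq ([::] : seq T) | _ <- s] = [::].
Proof. by elim: s. Qed.

Lemma ops_edges U : flatten [seq e.1 | e <- ops U] = edges U.
Proof.
rewrite /ops map_cat flatten_cat -map_comp /= -[RHS]cats0; congr (_ ++ _).
move: (size U) => m; elim: U => //= i V ih.
by rewrite map_cat flatten_cat ih cats0 map_nseq; elim: m {ih}.
Qed.

Lemma ops_sides U : flatten [seq e.2 | e <- ops U] = sides (size U) U.
Proof.
rewrite /ops map_cat flatten_cat -map_comp /= flatten_nil /=.
rewrite /sides; move: (size U) => m; elim: U => //= i V ih.
by rewrite map_cat flatten_cat ih map_nseq.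
Qed.

Lemma big_ops U (F : seq code * seq code -> R) :
  \sum_(e <- ops U) F e = \sum_(u <- pairs U) F (star u, [::])
     + (size U)%:R * \sum_(i <- U) F ([::], block i).
Proof.
rewrite /ops big_cat big_map; congr (_ + _).
rewrite big_flatten /= big_map mulr_sumr; apply: eq_bigr => i _.
by rewrite big_nseq iter_addr_0 mulr_natl.
Qed.

Variable q : 'I_L -> R.
Hypothesis hq : forall l, ssnr l = esnr l * q l.

Local Notation Etot := (\sum_l esnr l).
Local Notation Stot := (\sum_l ssnr l).
Local Notation sz U := ((size U)%:R : R).

Lemma info_edges_le U w : nonneg w ->
  info ch (edges U) w - info ch (sides (size U) U) w <=
  sz U ^+ 2 * (\sum_l esnr l / 4 * (1 - q l) ^+ 2
            + 8 * Etot * (kap + Etot) + 8 * Stot * (kap + Stot)) * mass w.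
Proof.
move=> w0; set N := sz U; have M0 := mass_ge0 w0.
have T0 : 0 <= Etot by apply: sumr_ge0 => l _; exact: esnr_ge0.
have S0 : 0 <= Stot by apply: sumr_ge0 => l _; exact: ssnr_ge0.
have K0 : 0 <= kap by case/andP: kap0.
have := @info_interpolation _ _ _ ch kap kap0 weak_ch (ops U)
  (N ^+ 2 * \sum_l esnr l / 4 * (1 - q l) ^+ 2) w _ w0.
rewrite ops_edges ops_sides => h; apply: le_trans (h _) _; last first.
  apply: ler_wpM2r => //; rewrite -addrA [X in _ <= X]mulrDr lerD2l big_ops /=.
  have nl : total ch [::] = 0 by rewrite /total big_nil.
  under eq_bigr => u _ do rewrite nl total_star addr0.
  under [\sum_(i <- U) _]eq_bigr => u _ do rewrite nl add0r total_block.
  rewrite !sum_const_seq -/N [N * (N * _)]mulrA -[N * N]expr2.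
  have hs := size_pairs U; rewrite -/N in hs.
  rewrite [X in _ <= X]mulrDr lerD2r; apply: ler_wpM2r hs.
  by apply: mulr_ge0; [exact: mulr_ge0 | exact: addr_ge0].
move=> v v0; rewrite big_ops /=.
have gn : gain ch [::] v = 0 by rewrite /gain big_nil.
rewrite gn.
have -> : \sum_(u <- pairs U) (gain ch (star u) v - 0) =
  \sum_l esnr l / 2 * \sum_(u <- pairs U) (mass v - post2 (fun x => sigma R u.1 l x * sigma R u.2 l x) v).
  under [RHS]eq_bigr => l _ do rewrite mulr_sumr.
  rewrite [RHS]exchange_big; apply: eq_bigr => -[i j] _ /=.
  by rewrite subr0 /gain big_star.
have -> : \sum_(i <- U) (0 - gain ch (block i) v) =
  - \sum_l esnr l / 2 * (q l * \sum_(i <- U) (mass v - post2 (sigma R i l) v)).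
  transitivity (- \sum_(i <- U) gain ch (block i) v).
    by rewrite -sumrN; apply: eq_bigr => i _; rewrite sub0r.
  congr (- _); under [RHS]eq_bigr => l _ do rewrite mulrA mulr_sumr.
  rewrite [RHS]exchange_big; apply: eq_bigr => i _ /=.
  rewrite /gain big_block; apply: eq_bigr => l _.
  by rewrite /= -[strength _]/(ssnr l) hq; ring.
rewrite mulrN [X in _ - X]mulr_sumr -sumrB -[X in _ <= X]mulrA [X in _ * X]mulr_suml [X in _ <= X]mulr_sumr.
apply: ler_sum => l _.
have := ler_wpM2l (_ : 0 <= esnr l / 2) (pairs_gain U l (q l) v0).
have th0 : 0 <= esnr l / 2 by rewrite divr_ge0 // esnr_ge0.
move=> /(_ th0).
rewrite -/N; lra.
Qed.

Let pi0_ge0 : nonneg pi0. Proof. exact: prior_ge0. Qed.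
Let mass_pi0 : mass pi0 = 1. Proof. exact: mass_prior. Qed.

Lemma sigma_corr (i : 'I_n) (l m : 'I_L) :
  lin (fun x => sigma R i l x * sigma R i m x) pi0 = corr rho l m.
Proof.
have := @prior_corr R n L rho hL i l m (fun=> 1).
rewrite linC mass_pi0 !mulr1 => <- //.
by apply: eq_bigr => x _; rewrite mulr1.
Qed.

Lemma total_edges U : total ch (edges U) <= sz U ^+ 2 * Etot.
Proof.
have T0 : 0 <= Etot by apply: sumr_ge0 => l _; exact: esnr_ge0.
rewrite /total big_flatten big_map /=.
rewrite (eq_bigr (fun=> Etot)); last by move=> u _; exact: total_star.
by rewrite sum_const_seq; apply: ler_wpM2r (size_pairs U).
Qed.

Definition pair_overlap (s : seq code) (l : 'I_L) (i j : 'I_n) : R :=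
  obs s (post2 (fun x => sigma R i l x * sigma R j l x)) pi0.

Lemma pair_overlap_diag s l i : pair_overlap s l i i = 1.
Proof.
rewrite /pair_overlap.
have -> : post2 (fun x : labels n L => sigma R i l x * sigma R i l x) = @mass R _.
  by apply/funext => w; exact: post2_diag.
by rewrite obs_mass mass_pi0.
Qed.

Lemma pair_overlapC s l i j : pair_overlap s l i j = pair_overlap s l j i.
Proof.
by rewrite /pair_overlap; congr (obs _ (post2 _) _); apply/funext => x; rewrite mulrC.
Qed.

(** By [info_ge_obs] every edge counts as the last one, so the overlaps that appear are those given
    the whole graph on [U]. *)
Lemma info_edges_ge U :
  \sum_l esnr l / 4 * (sz U ^+ 2 - \sum_(i <- U) \sum_(j <- U) pair_overlap (edges U) l i j)
    - 8 * kap * (sz U ^+ 2 * Etot) <= info ch (edges U) pi0.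
Proof.
have K0 : 0 <= kap by case/andP: kap0.
apply: le_trans (info_ge_obs kap0 weak_ch (edges U) pi0_ge0).
rewrite mass_pi0 mulr1; apply: lerB; last by rewrite ler_wpM2l ?mulr_ge0 // total_edges.
rewrite big_flatten big_map /= le_eqVlt; apply/orP; left; apply/eqP.
under [RHS]eq_bigr => u _ do rewrite big_star.
rewrite [RHS]exchange_big; apply: eq_bigr => l _ /=.
have h : \sum_(u <- pairs U) (1 - pair_overlap (edges U) l u.1 u.2) =
    2^-1 * (sz U ^+ 2 - \sum_(i <- U) \sum_(j <- U) pair_overlap (edges U) l i j).
  rewrite (big_pairs U (g := fun i j => 1 - pair_overlap (edges U) l i j)).
  - congr (_ * _); under eq_bigr => i _ do rewrite sumrB sum_const_seq mulr1.
    by rewrite sumrB sum_const_seq expr2.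
  - by move=> i j; rewrite pair_overlapC.
  - by move=> i; rewrite pair_overlap_diag subrr.
transitivity (\sum_(u <- pairs U) esnr l / 2 * (1 - pair_overlap (edges U) l u.1 u.2)).
  by rewrite -mulr_sumr h; field.
by apply: eq_bigr => -[i j] _.
Qed.

Definition copies (k : nat) (i : 'I_n) : seq code := flatten (nseq k (block i)).

Lemma copiesS k i : copies k.+1 i = copies k i ++ block i.
Proof.
by rewrite /copies; elim: k => [|k ih] /=; rewrite ?cats0 // -catA -ih.
Qed.

Lemma big_copies k i (F : code -> R) : \sum_(c <- copies k i) F c = k%:R * \sum_l F (inr (i, l)).
Proof.
elim: k => [|k ih]; first by rewrite big_nil mul0r.
by rewrite copiesS big_cat /= ih big_block -[k.+1]addn1 natrD mulrDl mul1r.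
Qed.

(** To first order, the squared posterior mean of a label of layer [l] given one block. *)
Definition csnr (l : 'I_L) : R := \sum_m corr rho l m ^+ 2 * ssnr m.

Lemma ssnr_sum_ge0 : 0 <= Stot.
Proof. by apply: sumr_ge0 => l _; exact: ssnr_ge0. Qed.

(** The statistic weights layer m by [corr rho l m]. Its covariance with the label counts k [csnr]
    twice, its noise takes away 1 + [kap] times k [csnr], and its squared conditional mean is at
    most (k Stot)^2. *)
Lemma copies_post2 k i l :
  k%:R * (1 - kap) * csnr l - (k%:R * Stot) ^+ 2 <= obs (copies k i) (post2 (sigma R i l)) pi0.
Proof.
pose a (c : code) : R := if c is inr (_, m) then corr rho l m else 0.
apply: le_trans (obs_ge_linear kap0 weak_ch (copies k i) a (sigma R i l) pi0_ge0).
have E1 : \sum_(c <- copies k i) a c ^+ 2 * strength (ch c) = k%:R * csnr l.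
  exact: big_copies.
pose Z x := \sum_m corr rho l m * ssnr m * sigma R i m x.
have E2 x : \sum_(c <- copies k i) a c * strength (ch c) * spin (ch c) x = k%:R * Z x.
  exact: (big_copies k i (fun c => a c * strength (ch c) * spin (ch c) x)).
apply: (@le_trans _ _ (lin (fun x => (2 * k%:R) * (\sum_m corr rho l m * ssnr m * (sigma R i l x * sigma R i m x))
   + (- (k%:R * Stot) ^+ 2 - (1 + kap) * (k%:R * csnr l))) pi0)).
  have E3 : lin (fun x => \sum_m corr rho l m * ssnr m * (sigma R i l x * sigma R i m x)) pi0 = csnr l.
    rewrite lin_sum; apply: eq_bigr => m _.
    by rewrite (linZ (corr rho l m * ssnr m)) sigma_corr; ring.
  rewrite linD linZ E3 linC mass_pi0; lra.
apply: (lin_mono pi0_ge0) => x; rewrite E1 E2.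
have -> : \sum_m corr rho l m * ssnr m * (sigma R i l x * sigma R i m x) = sigma R i l x * Z x.
  by rewrite mulr_sumr; apply: eq_bigr => m _; ring.
have ZS : `|Z x| <= Stot.
  apply: le_trans (ler_norm_sum _ _ _) _; apply: ler_sum => m _.
  have e0 := ssnr_ge0 m.
  rewrite (normrM (_ * _)) (normrM (corr rho l m)) (ger0_norm e0) (ger0_norm (corr_ge0 hrho l m)).
  have c0 := corr_ge0 hrho l m; have c1 := corr_le1 hrho l m; have s1 := sigma_norm R i m x.
  by rewrite mulrAC ler_piMl // mulr_ile1.
have ZS2 : (k%:R * Z x) ^+ 2 <= (k%:R * Stot) ^+ 2.
  have -> : (k%:R * Z x) ^+ 2 = (k%:R * `|Z x|) ^+ 2 by rewrite !exprMn real_normK ?num_real.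
  have S0 := ssnr_sum_ge0.
  apply: lerXn2r; rewrite ?nnegrE ?mulr_ge0 //.
  by apply: ler_wpM2l.
lra.
Qed.

Lemma block_info pre i k :
  obs (pre ++ copies k i) (info ch (block i)) pi0 <=
  \sum_l ssnr l / 2 * (1 - (k%:R * (1 - kap) * csnr l - (k%:R * Stot) ^+ 2)) + 8 * kap * Stot.
Proof.
have p0 := pi0_ge0.
apply: (@le_trans _ _ (obs (pre ++ copies k i)
   (fun w => gain ch (block i) w - gain ch [::] w + lin (fun=> 8 * kap * Stot) w) pi0)).
  apply: (obs_mono kap0 weak_ch) => // w w0.
  have := info_le kap0 weak_ch (block i) w0.
  by rewrite {2}/gain big_nil subr0 linC total_block.
rewrite obs_comb big_nil subr0 linC mass_pi0 mulr1 lerD2r big_block.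
apply: ler_sum => l _; apply: ler_wpM2l; first by rewrite divr_ge0 // ssnr_ge0.
rewrite lerD2l lerN2; apply: le_trans (copies_post2 k i l) _.
exact: (obs_le_catl kap0 weak_ch).
Qed.

(** Each block finds a posterior sharpened by its predecessors, and these savings add up to k (k -
    1) / 2. The fixed [M] makes the last error uniform in the induction; [pre] can only sharpen
    further. *)
Lemma copies_info (M : nat) pre i k : (k <= M)%N ->
  obs pre (info ch (copies k i)) pi0 <=
  \sum_l ssnr l / 2 * (k%:R - (1 - kap) * csnr l * (k%:R * (k%:R - 1) / 2) + k%:R * (M%:R * Stot) ^+ 2)
    + 8 * kap * (k%:R * Stot).
Proof.
elim: k => [|k ih] hk.
  have -> : info ch (copies 0 i) = lin (fun=> 0).
    by apply/funext => w; rewrite /info /noise !big_nil /= linC; ring.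
  rewrite obs_lin linC mulr0n !(mul0r, mulr0, addr0) sumr_ge0 // => l _.
  by rewrite !(mul0r, mulr0, subr0, addr0).
have -> : info ch (copies k.+1 i) = fun w => info ch (copies k i) w + obs (copies k i) (info ch (block i)) w.
  by apply/funext => w; rewrite copiesS info_cat.
rewrite obsD -obs_cat.
apply: le_trans (lerD (ih (ltnW hk)) (block_info pre i k)) _.
rewrite addrACA -big_split /=.
have S0 := ssnr_sum_ge0.
have -> : 8 * kap * (k%:R * Stot) + 8 * kap * Stot = 8 * kap * (k.+1%:R * Stot).
  by rewrite -[k.+1]addn1 natrD; ring.
rewrite lerD2r; apply: ler_sum => l _; rewrite -mulrDr.
apply: ler_wpM2l; first by rewrite divr_ge0 // ssnr_ge0.
have kM : (k%:R * Stot) ^+ 2 <= (M%:R * Stot) ^+ 2.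
  apply: lerXn2r; rewrite ?nnegrE ?mulr_ge0 //.
  by apply: ler_wpM2r => //; rewrite ler_nat ltnW.
by rewrite -[k.+1]addn1 natrD; lra.
Qed.

Lemma sides_info N U pre :
  obs pre (info ch (sides N U)) pi0 <= sz U *
  (\sum_l ssnr l / 2 * (N%:R - (1 - kap) * csnr l * (N%:R * (N%:R - 1) / 2) + N%:R * (N%:R * Stot) ^+ 2)
    + 8 * kap * (N%:R * Stot)).
Proof.
set B := (X in _ * X).
elim: U pre => [|i U ih] pre.
  have -> : info ch (sides N [::]) = lin (fun=> 0).
    by apply/funext => w; rewrite /info /noise !big_nil /= linC; ring.
  by rewrite obs_lin linC !mul0r.
have -> : info ch (sides N (i :: U)) = fun w => info ch (copies N i) w + obs (copies N i) (info ch (sides N U)) w.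
  by apply/funext => w; rewrite /sides /= info_cat.
rewrite obsD -obs_cat /= -[(size U).+1]add1n natrD mulrDl mul1r.
apply: lerD; last exact: ih.
exact: copies_info.
Qed.

(** The lower and the upper bound on the same information, rearranged. By [hq] the term -Stot/2 from
    the squares (1 - q)^2 cancels the leading term of the side information. *)
Lemma overlap_sum_ge U :
  sz U ^+ 2 * ((sz U - 1) * (1 - kap) / 4 * (\sum_l ssnr l * csnr l)
    - \sum_l esnr l * q l ^+ 2 / 4 - sz U ^+ 2 * Stot ^+ 3 / 2
    - 8 * Etot * (2 * kap + Etot) - 8 * Stot * (2 * kap + Stot))
  <= \sum_l esnr l / 4 * \sum_(i <- U) \sum_(j <- U) pair_overlap (edges U) l i j.
Proof.
have h1 := info_edges_ge U.
have h2 := info_edges_le U pi0_ge0.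
have h3 := sides_info (size U) U [::].
rewrite mass_pi0 mulr1 in h2.
set N := sz U in h1 h2 h3 *.
have E1 : \sum_l ssnr l / 2 * (N - (1 - kap) * csnr l * (N * (N - 1) / 2) + N * (N * Stot) ^+ 2)
  = Stot * (N + N * (N * Stot) ^+ 2) / 2
    - (1 - kap) * (N * (N - 1) / 4) * \sum_l ssnr l * csnr l.
  move: ((N * Stot) ^+ 2) => x.
  by rewrite !mulr_suml mulr_sumr -sumrB; apply: eq_bigr => l _; field.
have E2 : \sum_l esnr l / 4 * (1 - q l) ^+ 2 = Etot / 4 - Stot / 2 + \sum_l esnr l * q l ^+ 2 / 4.
  rewrite !mulr_suml -sumrB -big_split; apply: eq_bigr => l _ /=.
  by rewrite hq; field.
have E3 : \sum_l esnr l / 4 * (N ^+ 2 - \sum_(i <- U) \sum_(j <- U) pair_overlap (edges U) l i j)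
   = Etot / 4 * N ^+ 2 - \sum_l esnr l / 4 * \sum_(i <- U) \sum_(j <- U) pair_overlap (edges U) l i j.
  by rewrite !mulr_suml -sumrB; apply: eq_bigr => l _; rewrite mulrBr.
rewrite E3 in h1; rewrite E2 in h2; rewrite E1 /= in h3.
move: h1 h2 h3; set Q := \sum_l esnr l / 4 * _; set P := \sum_l esnr l * q l ^+ 2 / 4.
set C := \sum_l ssnr l * csnr l; set T := Etot; set S := Stot.
set IE := info _ _ _; set IS := info _ _ _; lra.
Qed.

End SBM.

(** * From one layer to all layers *)

Section Transfer.
Variables (R : realType) (n L : nat) (rho : R).
Hypotheses (hrho : 0 < rho < 1 / 2) (hL : (0 < L)%N).
Variables (p d side : 'I_L -> R) (kap : R).
Hypothesis kap0 : 0 <= kap <= 1 / 2.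
Hypothesis hp : forall l, 0 < p l < 1.
Hypothesis hd : forall l, `|d l| <= kap * (p l * (1 - p l)).
Hypothesis hside : forall l, `|side l| <= kap / 4.

Local Notation ch := (@ch R n L p d side).
Local Notation obs := (obs ch).
Local Notation pi0 := (@prior R n L rho).
Local Notation code := (code n L).
Local Notation esnr := (esnr p d).
Local Notation edges := (@edges n L).
Let wch := weak_ch (n := n) hp hd hside.
Let pi0_ge0 : nonneg pi0. Proof. exact: prior_ge0. Qed.
Let mass_pi0 : mass pi0 = 1. Proof. exact: mass_prior. Qed.

Definition avoids (i : 'I_n) (s : seq code) := forall c, c \in s -> free i (spin (ch c)).

(* Posterior weights reached from the prior without observing site [i]. *)
Definition untouched (i : 'I_n) (w : labels n L -> R) :=
  nonneg w /\ exists2 h, free i h & w = fun x => pi0 x * h x.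

Lemma obs_mono_untouched i s F G w : avoids i s ->
  (forall w, untouched i w -> F w <= G w) -> untouched i w -> obs s F w <= obs s G w.
Proof.
move=> hs FG; elim: s w hs => [|c s ih] w hs hw; first exact: FG.
have hc : free i (spin (ch c)) by apply: hs; rewrite mem_head.
have hs' : avoids i s by move=> c' hc'; apply: hs; rewrite inE hc' orbT.
case: hw => w0 [h hh hw].
apply: lerD; apply: ih => //; split.
- exact: (nonneg_prob kap0 (wch c) w0).
- exists (fun x => h x * prob (ch c) x); last by apply/funext => x; rewrite hw mulrA.
  by move=> x z; rewrite hh /prob hc.
- exact: (nonneg_probC kap0 (wch c) w0).
- exists (fun x => h x * (1 - prob (ch c) x)); last by apply/funext => x; rewrite hw mulrA.
  by move=> x z; rewrite hh /prob hc.
Qed.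

Lemma obs_wsum (J : Type) (r : seq J) s (a b : R) (Fs : J -> (labels n L -> R) -> R) w :
  obs s (fun w => a * \sum_(j <- r) Fs j w + b * mass w) w =
  a * \sum_(j <- r) obs s (Fs j) w + b * mass w.
Proof.
elim: s w => //= c s ih w.
have -> : obs s (fun w => a * \sum_(j <- r) Fs j w + b * mass w) =
  fun w => a * \sum_(j <- r) obs s (Fs j) w + b * mass w by exact/funext.
by rewrite -(split_mass (ch c) w) /split big_split /=; ring.
Qed.

Definition ecode (i u : 'I_n) (m : 'I_L) : code :=
  if (i < u)%N then inl (i, u, m) else inl (u, i, m).
Definition spokes (i : 'I_n) (V : seq 'I_n) (m : 'I_L) := [seq ecode i u m | u <- V].

Lemma ch_ecode i u m : ch (ecode i u m) =
  Channel (p m) (d m) (fun x => sigma R i m x * sigma R u m x).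
Proof.
rewrite /ecode; case: ifP => // _; congr Channel.
by apply/funext => x; rewrite mulrC.
Qed.

(** As long as nothing about [i] is seen, its row keeps the prior law, so the edge to [u] informs
    about layer [l] through [corr rho l m] times the posterior mean [C u]. These means are constants
    for each posterior and serve as weights; [bet] is left free for optimisation. *)
Lemma transfer (i : 'I_n) (V : seq 'I_n) (l m : 'I_L) s (g : labels n L -> R) (bet : R) :
  i \notin V -> avoids i s -> free i g -> (forall x, `|g x| <= 1) ->
  2 * bet * esnr m * corr rho l m *
     \sum_(u <- V) obs s (post2 (fun x => sigma R u m x * g x)) pi0
  - bet ^+ 2 * ((esnr m * (size V)%:R) ^+ 2 + 2 * (esnr m * (size V)%:R))
  <= obs (s ++ spokes i V m) (post2 (fun x => sigma R i l x * g x)) pi0.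
Proof.
move=> iV hs hg g1.
have e0 : 0 <= esnr m := esnr_ge0 d hp m.
set y := esnr m * (size V)%:R.
have y0 : 0 <= y by rewrite mulr_ge0.
set B := bet ^+ 2 * _.
rewrite obs_cat (_ : B = B * mass pi0); last by rewrite mass_pi0 mulr1.
rewrite -mulNr -obs_wsum.
apply: (@obs_mono_untouched i) => //; last first.
  by split=> //; exists (fun=> 1) => //; apply/funext => x; rewrite mulr1.
move=> w [w0 [h hh hw]].
pose C u := lin (fun x => sigma R u m x * g x) w / mass w.
have C1 u : `|C u| <= 1.
  have := mass_ge0 w0; rewrite le_eqVlt => /orP[/eqP E|S0].
    by rewrite /C -E invr0 mulr0 normr0.
  rewrite /C normrM (gtr0_norm (x := (mass w)^-1)) ?invr_gt0 // ler_pdivrMr //.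
  apply: lin_le => // x; rewrite normrM mulr_ile1 //; exact: sigma_norm.
(* The weight is read off the endpoint other than [i], whichever comes first in the code. *)
pose a (c : code) : R := if c is inl (u, v, _) then bet * C (if u == i then v else u) else 0.
have aE u : u \in V -> a (ecode i u m) = bet * C u.
  move=> uV; rewrite /a /ecode; case: ifP => _; rewrite ?eqxx //.
  by case: eqP => // ui; move: iV; rewrite -ui uV.
apply: le_trans (obs_ge_linear kap0 wch (spokes i V m) a (fun x => sigma R i l x * g x) w0).
have E1 : \sum_(c <- spokes i V m) a c ^+ 2 * strength (ch c) = \sum_(u <- V) (bet * C u) ^+ 2 * esnr m.
  by rewrite big_map big_seq [RHS]big_seq; apply: eq_bigr => u uV; rewrite aE // ch_ecode.
have E2 x : \sum_(c <- spokes i V m) a c * strength (ch c) * spin (ch c) x =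
   bet * esnr m * sigma R i m x * \sum_(u <- V) C u * sigma R u m x.
  rewrite big_map mulr_sumr big_seq [RHS]big_seq; apply: eq_bigr => u uV.
  by rewrite aE // ch_ecode /= -[strength _]/(esnr m); ring.
have V1 : \sum_(u <- V) (bet * C u) ^+ 2 * esnr m <= bet ^+ 2 * y.
  have -> : bet ^+ 2 * y = \sum_(u <- V) bet ^+ 2 * esnr m.
    by rewrite sum_const_seq /y; ring.
  apply: ler_sum => u _; apply: ler_wpM2r => //; rewrite exprMn.
  by rewrite ler_piMr ?sqr_ge0 // -(ger0_norm (sqr_ge0 _)) normrX expr_le1.
have V2 x : (bet * esnr m * sigma R i m x * \sum_(u <- V) C u * sigma R u m x) ^+ 2 <= bet ^+ 2 * y ^+ 2.
  rewrite -exprMn -(ger0_norm (sqr_ge0 (bet * y))) -(ger0_norm (sqr_ge0 (_ * \sum_(u <- V) _))) !normrX.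
  apply: lerXn2r; rewrite ?nnegrE //.
  rewrite (normrM (_ * _)) (normrM (bet * _)) (normrM bet) (ger0_norm e0) (normrM bet) (ger0_norm y0).
  rewrite -[X in X <= _]mulrA /y [X in _ <= X]mulrA.
  apply: ler_wpM2l; first by rewrite mulr_ge0.
  rewrite -[X in _ <= X]mul1r; apply: ler_pM => //; first exact: sigma_norm.
  apply: le_trans (ler_norm_sum _ _ _) _.
  have -> : (size V)%:R = \sum_(u <- V) 1 :> R by rewrite sum_const_seq mulr1.
  by apply: ler_sum => u _; rewrite normrM mulr_ile1 // sigma_norm.
have E3 u : u \in V -> lin (fun x => sigma R i l x * sigma R i m x * (sigma R u m x * g x)) w =
    corr rho l m * lin (fun x => sigma R u m x * g x) w.
  move=> uV; have ui : u != i by apply: contraNneq iV => <-.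
  rewrite hw !lin_mul -(@prior_corr R n L rho hL i l m (fun x => h x * (sigma R u m x * g x))).
    by apply: eq_bigr => x _; ring.
  by move=> x z; rewrite hh hg (sigma_free R m ui).
have E4 : 2 * bet * esnr m * corr rho l m * \sum_(u <- V) post2 (fun x => sigma R u m x * g x) w =
   lin (fun x => 2 * bet * esnr m * \sum_(u <- V) C u * (sigma R i l x * sigma R i m x * (sigma R u m x * g x))) w.
  rewrite linZ lin_sum -[LHS]mulrA mulr_sumr; congr (_ * _).
  rewrite big_seq [RHS]big_seq; apply: eq_bigr => u uV.
  by rewrite (linZ (C u)) E3 // /post2 /C; ring.
rewrite E4 -linC -linD; apply: (lin_mono w0) => x; rewrite E1 E2.
(* This is the 2 in front of y; the term y^2 bounds the squared conditional mean. *)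
have k1 : 1 + kap <= 2 by case/andP: kap0; lra.
have := V2 x; set X := (_ * _ * \sum_(u <- V) _) ^+ 2 => hX.
have Z0 : 0 <= \sum_(u <- V) (bet * C u) ^+ 2 * esnr m.
  by apply: sumr_ge0 => u _; rewrite mulr_ge0 ?sqr_ge0.
have Y0 : 0 <= bet ^+ 2 * y by rewrite mulr_ge0 ?sqr_ge0.
have hV : (1 + kap) * \sum_(u <- V) (bet * C u) ^+ 2 * esnr m <= 2 * (bet ^+ 2 * y).
  by apply: ler_pM => //; case/andP: kap0; lra.
have -> : 2 * (sigma R i l x * g x) *
   (bet * esnr m * sigma R i m x * \sum_(u <- V) C u * sigma R u m x) =
   2 * bet * esnr m * \sum_(u <- V) C u * (sigma R i l x * sigma R i m x * (sigma R u m x * g x)).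
  rewrite !mulr_sumr; apply: eq_bigr => u _; ring.
rewrite /B; move: hV hX; set W := \sum_(u <- V) _; set Y := \sum_(u <- V) _; lra.
Qed.

Lemma mem_edges U i j l : (inl (i, j, l) \in edges U) = [&& i \in U, j \in U & (i < j)%N].
Proof.
apply/flatten_mapP/idP => [[[i' j'] /allpairsPdep [i0 [j0 [hi hj [-> ->]]]]]|].
  by case/mapP => l' _ [-> -> _]; move: hj; rewrite mem_filter hi => /andP[-> ->].
move=> /and3P[hi hj ij]; exists (i, j); last by apply/mapP; exists l => //; rewrite mem_enum.
by apply/allpairsPdep; exists i, j; rewrite mem_filter ij.
Qed.

Lemma edges_inl U c : c \in edges U -> exists u, c = inl u.
Proof. by case/flatten_mapP => u _ /mapP[l _ ->]; exists (u, l). Qed.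

Lemma edges_uniq (U : seq 'I_n) : uniq U -> uniq (edges U).
Proof.
move=> uU; rewrite /edges -[flatten _]/[seq (inl (u, l) : code) | u <- pairs U, l <- enum 'I_L].
apply: allpairs_uniq; last by move=> [u l] [u' l'] _ _ /= [-> ->].
  apply: allpairs_uniq_dep => //.
    by move=> i _; exact: filter_uniq.
  by move=> [i j] [i' j'] _ _ /= [-> ->].
exact: enum_uniq.
Qed.

Lemma ecode_inj i m : injective (fun u => ecode i u m).
Proof.
move=> u v; rewrite /ecode; case: ifP => h1; case: ifP => h2 [] //.
  by move=> e1 e2; rewrite -e1 e2.
by move=> e1 e2; rewrite e1 -e2.
Qed.

Lemma mem_ecode V i u m : u != i -> (ecode i u m \in edges V) = (i \in V) && (u \in V).
Proof.
move=> ui; rewrite /ecode; case: ifP => h; rewrite mem_edges.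
  by rewrite h andbT.
have -> : (u < i)%N by rewrite ltn_neqAle leqNgt h (inj_eq (@ord_inj n)) ui.
by rewrite andbT andbC.
Qed.

Lemma edges_avoids i U : i \notin U -> avoids i (edges U).
Proof.
move=> iU [[[u v] l]|c] hc; last by have [] := edges_inl hc.
move: hc; rewrite mem_edges => /and3P[hu hv _] x z /=.
have hi w : w \in U -> w != i by apply: contraTneq => ->.
by rewrite !sigma_free // hi.
Qed.

Lemma spokes_avoids i j U m : j \notin U -> j != i -> avoids j (spokes i U m).
Proof.
move=> jU ji c /mapP[u uU ->] x z; rewrite ch_ecode /=.
have uj : u != j by apply: contraTneq uU => ->.
by rewrite !sigma_free // eq_sym.
Qed.

(** The three lists are disjoint: [i] is absent from the first, and [j] from the first two. *)
Lemma obs_two_spokes i j U m f : i != j -> uniq U -> i \notin U -> j \notin U ->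
  obs ((edges U ++ spokes i U m) ++ spokes j U m) (post2 f) pi0 <=
  obs (edges (enum 'I_n)) (post2 f) pi0.
Proof.
move=> ij uU iU jU.
have neq k u : k \notin U -> u \in U -> u != k by move=> kU uU'; apply: contraNneq kU => <-.
apply: (obs_le_subset kap0 wch) => //; last 2 first.
- exact/edges_uniq/enum_uniq.
- move=> c; rewrite !mem_cat => /orP[/orP[hc|]|].
  + have [[[u v] l] E] := edges_inl hc; move: hc; rewrite E !mem_edges !mem_enum.
    by case/and3P.
  + by case/mapP => u uU' ->; rewrite mem_ecode ?mem_enum // neq.
  + by case/mapP => u uU' ->; rewrite mem_ecode ?mem_enum // neq.
rewrite !cat_uniq edges_uniq //= !(map_inj_uniq (@ecode_inj _ _)) uU !andbT /=.
apply/andP; split.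
  apply/hasPn => c /mapP[u uU' ->]; rewrite mem_ecode ?neq //.
  by rewrite (negbTE iU).
apply/hasPn => c /mapP[u uU' ->]; rewrite mem_cat mem_ecode ?neq //.
rewrite (negbTE jU) /=; apply/negP => /mapP[v vU].
have uj := neq _ _ jU uU'; have vi := neq _ _ iU vU; have vj := neq _ _ jU vU.
rewrite /ecode; case: ifP => _; case: ifP => _ [] e1 e2 //.
- by rewrite e1 eqxx in ij.
- by rewrite e1 eqxx in vj.
- by rewrite e2 eqxx in vj.
- by rewrite e2 eqxx in ij.
Qed.

(** [transfer] is used at [i] against each site of [U], then at [j] against [i]: an average overlap
    q becomes K q^2 and then K (K q^2)^2. *)
Lemma overlap_transfer i j U (l m : 'I_L) (q : R) :
  i != j -> uniq U -> i \notin U -> j \notin U -> 0 <= q ->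
  0 < esnr m * (size U)%:R ->
  q * (size U)%:R ^+ 2 <= \sum_(u <- U) \sum_(v <- U) pair_overlap rho p d side (edges U) m u v ->
  (esnr m * (size U)%:R * corr rho l m ^+ 2 / (esnr m * (size U)%:R + 2)) ^+ 3 * q ^+ 4
  <= pair_overlap rho p d side (edges (enum 'I_n)) l i j.
Proof.
move=> ij uU iU jU q0 y0 hq.
set y := esnr m * (size U)%:R in y0 *; set C := corr rho l m; pose N : R := (size U)%:R; rewrite -/N in hq.
have C0 : 0 <= C := corr_ge0 hrho l m.
have e0 : 0 <= esnr m := esnr_ge0 d hp m.
set K := y * C ^+ 2 / (y + 2).
have K0 : 0 <= K.
  by apply: divr_ge0; [apply: mulr_ge0; [exact: ltW | exact: sqr_ge0] | lra].
have neq k u : k \notin U -> u \in U -> u != k by move=> kU uU'; apply: contraNneq kU => <-.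
pose s1 := edges U ++ spokes i U m.
have step1 : N * (K * q ^+ 2) <= \sum_(v <- U) obs s1 (post2 (fun x => sigma R i l x * sigma R v m x)) pi0.
  (* The maximiser of 2 be y C q - be^2 (y^2 + 2 y). *)
  pose be := C * q / (y + 2).
  have h v : v \in U -> 2 * be * esnr m * C * \sum_(u <- U) pair_overlap rho p d side (edges U) m u v
      - be ^+ 2 * (y ^+ 2 + 2 * y) <= obs s1 (post2 (fun x => sigma R i l x * sigma R v m x)) pi0.
    move=> vU; apply: (transfer l m (g := sigma R v m) be) => //.
    - exact: edges_avoids.
    - by apply: sigma_free; exact: neq.
    - by move=> x; exact: sigma_norm.
  have : \sum_(v <- U) (2 * be * esnr m * C * \sum_(u <- U) pair_overlap rho p d side (edges U) m u v
      - be ^+ 2 * (y ^+ 2 + 2 * y)) <= \sum_(v <- U) obs s1 (post2 (fun x => sigma R i l x * sigma R v m x)) pi0.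
    by rewrite big_seq [X in _ <= X]big_seq; apply: ler_sum => v vU; exact: h.
  apply: le_trans; rewrite sumrB sum_const_seq -mulr_sumr exchange_big /= -/N.
  have be0 : 0 <= be by apply: divr_ge0; [exact: mulr_ge0 | lra].
  have b0 : 0 <= 2 * be * esnr m * C.
    by do 2!(apply: mulr_ge0 => //); apply: mulr_ge0.
  apply: le_trans (lerB (ler_wpM2l b0 hq) (lexx _)).
  rewrite le_eqVlt; apply/orP; left; apply/eqP.
  transitivity (N * (2 * be * y * C * q) - N * (be ^+ 2 * (y ^+ 2 + 2 * y))); last by rewrite /y; ring.
  by rewrite /be /K; field; lra.
pose q' := K * q ^+ 2.
pose be := C * q' / (y + 2).
apply: (@le_trans _ _ (obs (s1 ++ spokes j U m) (post2 (fun x => sigma R j l x * sigma R i l x)) pi0)); last first.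
  by rewrite pair_overlapC; exact: obs_two_spokes.
have h : 2 * be * esnr m * C * \sum_(u <- U) obs s1 (post2 (fun x => sigma R u m x * sigma R i l x)) pi0
    - be ^+ 2 * (y ^+ 2 + 2 * y) <= obs (s1 ++ spokes j U m) (post2 (fun x => sigma R j l x * sigma R i l x)) pi0.
  apply: (transfer l m (g := sigma R i l) be) => //.
  - move=> c; rewrite mem_cat => /orP[|]; first exact: edges_avoids.
    by apply: spokes_avoids => //; rewrite eq_sym.
  - exact: sigma_free.
  - by move=> x; exact: sigma_norm.
apply: le_trans h.
have q'0 : 0 <= q' by apply: mulr_ge0 => //; exact: sqr_ge0.
have be0 : 0 <= be by apply: divr_ge0; [exact: mulr_ge0 | lra].
have b0 : 0 <= 2 * be * esnr m * C.
  by do 2!(apply: mulr_ge0 => //); apply: mulr_ge0.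
have -> : \sum_(u <- U) obs s1 (post2 (fun x => sigma R u m x * sigma R i l x)) pi0 =
    \sum_(v <- U) obs s1 (post2 (fun x => sigma R i l x * sigma R v m x)) pi0.
  apply: eq_bigr => u _; congr (obs _ (post2 _) _).
  by apply/funext => x; rewrite mulrC.
apply: le_trans (lerB (ler_wpM2l b0 step1) (lexx _)).
rewrite le_eqVlt; apply/orP; left; apply/eqP.
transitivity (2 * be * y * C * q' - be ^+ 2 * (y ^+ 2 + 2 * y)); last by rewrite /y /q'; ring.
by rewrite /be /q' /K; field; lra.
Qed.

End Transfer.

(** * The threshold *)

Section Spectrum.
Variables (R : realType) (L : nat) (rho : R).
Hypotheses (hrho : 0 < rho < 1 / 2) (hL : (0 < L)%N).
Let c : R := (1 - 2 * rho) ^+ 2.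
Let A : R := (L%:R + 1) / 2.
Let B : R := (L%:R - 1) / 2.

Let c0 : 0 < c. Proof. by rewrite exprn_gt0 //; move/andP: hrho => [h1 h2]; lra. Qed.
Let c1 : c < 1.
Proof.
by rewrite expr_lt1 //; move/andP: hrho => [h1 h2]; lra.
Qed.
Let B0 : 0 <= B.
Proof. by rewrite divr_ge0 // subr_ge0 ler1n. Qed.
Let AB : A = B + 1. Proof. by rewrite /A /B; field. Qed.

(* [theta_equation] says that [2 * even_eq t * odd_eq t = 0]; the two factors
   give the symmetric and the antisymmetric eigenvectors of the matrix
   [c ^ `|l - m|]. *)
Definition even_eq (t : R) := cos (A * t) - c * cos (B * t).
Definition odd_eq (t : R) := sin (A * t) - c * sin (B * t).

Lemma theta_equationE t : theta_equation L rho t <-> even_eq t * odd_eq t = 0.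
Proof.
rewrite /theta_equation.
have -> : (L%:R + 1) * t = A * t + A * t by rewrite /A; field.
have -> : (L%:R - 1) * t = B * t + B * t by rewrite /B; field.
have -> : L%:R * t = A * t + B * t by rewrite /A /B; field.
have -> : (1 - 2 * rho) ^+ 4 = c ^+ 2 by rewrite /c -exprM.
rewrite -/c !sinD /even_eq /odd_eq.
by split=> h; [apply: (@mulfI _ 2) => //; rewrite mulr0 h | ]; lra.
Qed.

Section Root.
Variable th : R.
Hypotheses (th0 : 0 < th) (thA : A * th < pi / 2).

Lemma odd_eq_gt0 (t : R) : 0 < t <= th -> 0 < odd_eq t.
Proof.
have hth0 := th0; have hthA := thA.
have hc0 := c0; have hc1 := c1; have hB0 := B0.
move=> /andP[t0 tth].
have A1 : 1 <= A by rewrite AB; lra.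
have At : A * t <= A * th by rewrite ler_pM2l //; lra.
have At0 : 0 < A * t by rewrite mulr_gt0 //; lra.
have BAt : B * t < A * t by rewrite ltr_pM2r // AB; lra.
have Bt0 : 0 <= B * t by rewrite mulr_ge0 // ltW.
have sA : 0 < sin (A * t) by apply: sin_gt0_pihalf; rewrite At0 /=; lra.
have sB : sin (B * t) <= sin (A * t).
  have P0 := pi_gt0 R.
  by apply: ltW; rewrite ltr_sin // in_itv /=; apply/andP; split; lra.
have : c * sin (B * t) <= c * sin (A * t) by rewrite ler_pM2l.
have : c * sin (A * t) < 1 * sin (A * t) by rewrite ltr_pM2r.
rewrite /odd_eq; lra.
Qed.

(** Two zeros would give cos(A t) cos(B th) = cos(A th) cos(B t). Turned into sums of cosines, with
    A - B = 1, the right side is strictly smaller. *)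
Lemma even_eq_inj (t : R) : 0 < t < th -> even_eq t = 0 -> even_eq th <> 0.
Proof.
have hth0 := th0; have hthA := thA.
have hc0 := c0; have hc1 := c1; have hB0 := B0.
move=> /andP[t0 tth] /eqP; rewrite subr_eq0 => /eqP E1 /eqP; rewrite subr_eq0 => /eqP E2.
have A1 : 1 <= A by rewrite AB; lra.
have At : A * t < A * th by rewrite ltr_pM2l //; lra.
have At0 : 0 < A * t by rewrite mulr_gt0 //; lra.
have Bt0 : 0 <= B * t by rewrite mulr_ge0 // ltW.
have Bt : B * t <= B * th by rewrite ler_wpM2l // ltW.
have BA : B * th < A * th by rewrite ltr_pM2r // AB; lra.
have ABt : A * t = B * t + t by rewrite AB; ring.
have ABth : A * th = B * th + th by rewrite AB; ring.
have P0 := pi_gt0 R.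
have h1 : cos (A * th + B * t) < cos (A * t + B * th).
  by rewrite ltr_cos // ?in_itv /=; first lra; apply/andP; split; lra.
have h2 : cos (A * th - B * t) < cos (A * t - B * th).
  rewrite -[X in _ < X]cos_norm ltr_cos ?in_itv /=.
  - by rewrite ltr_norml; apply/andP; split; lra.
  - by rewrite normr_ge0 /= ler_norml; apply/andP; split; lra.
  - by apply/andP; split; lra.
have E : cos (A * t) * cos (B * th) = cos (A * th) * cos (B * t) by rewrite E1 E2; ring.
move: h1 h2; rewrite !cosD !cosN !sinN; lra.
Qed.

End Root.

(** [even_eq] is 1 - c at 0 and negative at pi / (2 A), so it vanishes in between; neither factor of
    the equation has an earlier zero. *)
Lemma theta_star_exists :
  exists th, [/\ is_theta_star L rho th, A * th < pi / 2 & even_eq th = 0].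
Proof.
have hc0 := c0; have hc1 := c1; have hB0 := B0.
have P0 := pi_gt0 R.
have A1 : 1 <= A by rewrite AB; lra.
pose b := pi / 2 / A.
have b0 : 0 < b by rewrite !divr_gt0 //; lra.
have Ab : A * b = pi / 2 by rewrite /b mulrC divfK //; lra.
have g0 : 0 < even_eq 0 by rewrite /even_eq !mulr0 cos0; lra.
have gb : even_eq b < 0.
  rewrite /even_eq Ab cos_pihalf sub0r oppr_lt0 mulr_gt0 // cos_gt0_pihalf //.
  have : B * b < A * b by rewrite ltr_pM2r // AB; lra.
  have : 0 <= B * b by rewrite mulr_ge0 // ltW.
  by move=> h1 h2; apply/andP; split; lra.
have cont : {within `[0, b], continuous even_eq}.
  apply: continuous_subspaceT => x.
  have cc k : {for x, continuous (fun y : R => cos (k * y))}.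
    apply: (@continuous_comp _ _ _ (fun y : R => k * y) (@cos R)); last exact: continuous_cos.
    by apply: cvgM; [exact: cvg_cst | exact: cvg_id].
  apply: cvgB; first exact: cc.
  by apply: cvgM; [exact: cvg_cst | exact: cc].
have [|th] := IVT (ltW b0) cont (v := 0).
  by rewrite ge_min le_max (ltW g0) (ltW gb) orbT.
rewrite in_itv /= => /andP[h0 hb] E.
have th0 : 0 < th.
  by rewrite lt_neqAle h0 andbT; apply/eqP => e; move: g0; rewrite [in even_eq _]e E ltxx.
have thb : th < b.
  by rewrite lt_neqAle hb andbT; apply/eqP => e; move: gb; rewrite -e E ltxx.
have thA : A * th < pi / 2 by rewrite -Ab ltr_pM2l //; lra.
exists th; split=> //; split.
- rewrite th0 /=.
  have : 1 * th <= A * th by rewrite ler_pM2r.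
  lra.
- by apply/theta_equationE; rewrite E mul0r.
- move=> t /andP[t0 tpi] /theta_equationE /eqP; rewrite mulf_eq0 leNgt => h.
  apply/negP => tth; case/orP: h => /eqP h.
    by apply: (even_eq_inj th0 thA _ h E); rewrite t0 tth.
  have := odd_eq_gt0 th0 thA (t := t); rewrite h ltxx t0 (ltW tth).
  by move=> /(_ isT).
Qed.

Section Eigenvector.
Variable th : R.
Hypotheses (th0 : 0 < th) (thA : A * th < pi / 2) (hth : even_eq th = 0).

(** A cosine centred at the middle layer: on the layers its angle stays within B th < pi / 2, hence
    positivity. *)
Definition eigv (k : nat) : R := cos ((k%:R - B) * th).
Let D := 1 - 2 * c * cos th + c ^+ 2.

Lemma eigv_rec k : eigv k.+2 + eigv k = 2 * cos th * eigv k.+1.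
Proof.
rewrite /eigv.
have -> : (k.+2%:R - B) * th = (k.+1%:R - B) * th + th by rewrite -[k.+2]addn1 natrD; ring.
have -> : (k%:R - B) * th = (k.+1%:R - B) * th - th by rewrite -[k.+1]addn1 natrD; ring.
by rewrite cosD cosB; ring.
Qed.

(** The boundary condition v(-1) = c v(0): the left side continues the cosine to layer -1, where
    [even_eq] fixes its value. *)
Lemma eigv_left : 2 * cos th * eigv 0 - eigv 1 = c * eigv 0.
Proof.
have E : cos (A * th) = c * eigv 0.
  by move/eqP: hth; rewrite subr_eq0 => /eqP ->; rewrite /eigv sub0r mulNr cosN.
rewrite -E /eigv.
have -> : (1%:R - B) * th = (0%:R - B) * th + th by ring.
have -> : A * th = - ((0%:R - B) * th - th) by rewrite AB; ring.
by rewrite cosN cosD cosB; ring.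
Qed.

Lemma eigv_right k : L = k.+1 -> eigv k.+1 = c * eigv k.
Proof.
move=> Lk; have LB : k%:R - B = B by rewrite /B Lk -[k.+1]addn1 natrD; field.
move/eqP: hth; rewrite subr_eq0 /eigv LB => /eqP <-; congr (cos (_ * _)).
by rewrite -[k.+1]addn1 natrD AB -{2}LB; ring.
Qed.

Lemma eigv_gt0 k : (k < L)%N -> 0 < eigv k.
Proof.
have hth0 := th0; have hthA := thA.
have hc0 := c0; have hc1 := c1; have hB0 := B0.
move=> kL; apply: cos_gt0_pihalf.
have k0 : 0 <= k%:R :> R by [].
have k1 : k%:R + 1 <= L%:R :> R by rewrite natr1 ler_nat.
have h1 : - (B * th) <= (k%:R - B) * th by rewrite -mulNr ler_pM2r //; lra.
have h2 : (k%:R - B) * th <= B * th by rewrite ler_pM2r // /B; lra.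
have : B * th < A * th by rewrite ltr_pM2r // AB; lra.
by move=> h3; apply/andP; split; lra.
Qed.

(** The sum at k + 1 is c times the sum at k plus one term; the cosine recursion closes the
    induction, which the left boundary condition starts. *)
Lemma eigv_below k : D * (\sum_(0 <= m < k.+1) c ^+ (k - m) * eigv m) = eigv k - c * eigv k.+1.
Proof.
elim: k => [|k ih].
  rewrite big_nat1 subnn expr0 mul1r /D.
  have := eigv_left; set v0 := eigv 0; set v1 := eigv 1; set x := cos th => h.
  have : c * (2 * x * v0 - v1) = c * (c * v0) by rewrite h.
  lra.
rewrite big_nat_recr //= subnn expr0 mul1r mulrDr.
have -> : \sum_(0 <= m < k.+1) c ^+ (k.+1 - m) * eigv m = c * \sum_(0 <= m < k.+1) c ^+ (k - m) * eigv m.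
  rewrite mulr_sumr big_nat [RHS]big_nat; apply: eq_bigr => m /andP[_ mk].
  by rewrite subSn // exprS mulrA.
rewrite mulrCA ih /D.
have := eigv_rec k; set v0 := eigv k; set v1 := eigv k.+1; set v2 := eigv k.+2; set x := cos th => h.
have : c * (v2 + v0) = c * (2 * x * v1) by rewrite h.
lra.
Qed.

(** The induction descends from the last layer, where the sum is empty and the right boundary
    condition makes the right side 0. *)
Lemma eigv_above k : (k < L)%N ->
  D * (\sum_(k.+1 <= m < L) c ^+ (m - k) * eigv m) = c * eigv k.+1 - c ^+ 2 * eigv k.
Proof.
move=> kL; have [j] := ubnP (L - k)%N; elim: j k kL => // j ih k kL hj.
have [kL1|kL1] := ltnP k.+1 L; last first.
  rewrite big_geq // mulr0 (@eigv_right k); first by ring.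
  by apply/eqP; rewrite eqn_leq kL1 kL.
rewrite big_ltn // subSnn expr1.
have -> : \sum_(k.+2 <= m < L) c ^+ (m - k) * eigv m = c * \sum_(k.+2 <= m < L) c ^+ (m - k.+1) * eigv m.
  rewrite mulr_sumr big_nat [RHS]big_nat; apply: eq_bigr => m /andP[mk _].
  by rewrite mulrA -exprS -subSn ?(ltnW mk) // subSS.
rewrite mulrDr [D * (c * \sum_(_ <= _ < _) _)]mulrCA ih //; last first.
  by rewrite -ltnS (leq_trans _ hj) // ltnS ltn_sub2l.
rewrite /D; have := eigv_rec k; set v0 := eigv k; set v1 := eigv k.+1; set v2 := eigv k.+2; set x := cos th => h.
have : c * (c * (v2 + v0)) = c * (c * (2 * x * v1)) by rewrite h.
lra.
Qed.

Lemma corr2E (l m : 'I_L) : corr rho l m ^+ 2 = c ^+ (l - m + (m - l)).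
Proof. by rewrite /corr exprAC. Qed.

Lemma eigv_eigen (l : 'I_L) :
  D * (\sum_(m < L) corr rho l m ^+ 2 * eigv m) = (1 - c ^+ 2) * eigv l.
Proof.
have -> : \sum_(m < L) corr rho l m ^+ 2 * eigv m =
   \sum_(0 <= m < L) c ^+ (l - m + (m - l)) * eigv m.
  by rewrite big_mkord; apply: eq_bigr => m _; rewrite corr2E.
rewrite (@big_cat_nat _ _ _ l.+1) //= mulrDr.
have -> : \sum_(0 <= m < l.+1) c ^+ (l - m + (m - l)) * eigv m = \sum_(0 <= m < l.+1) c ^+ (l - m) * eigv m.
  rewrite big_nat [RHS]big_nat; apply: eq_bigr => m /andP[_ ml].
  by rewrite (eqP (_ : (m - l == 0)%N)) ?addn0.
have -> : \sum_(l.+1 <= m < L) c ^+ (l - m + (m - l)) * eigv m = \sum_(l.+1 <= m < L) c ^+ (m - l) * eigv m.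
  rewrite big_nat [RHS]big_nat; apply: eq_bigr => m /andP[lm _].
  by rewrite (eqP (_ : (l - m == 0)%N)) ?add0n // subn_eq0 ltnW.
by rewrite eigv_below eigv_above //; ring.
Qed.

(** The threshold is the reciprocal of the eigenvalue (1 - c^2) / D. *)
Lemma eigv_supercritical (lambda : R) : dyn_threshold rho th < lambda ->
  \sum_(l < L) eigv l ^+ 2 <
    lambda * \sum_(l < L) eigv l * \sum_(m < L) corr rho l m ^+ 2 * eigv m.
Proof.
have hth0 := th0; have hthA := thA.
have hc0 := c0; have hc1 := c1; have hB0 := B0.
rewrite /dyn_threshold -/c.
have -> : (1 - 2 * rho) ^+ 4 = c ^+ 2 by rewrite /c -exprM.
rewrite -/D => hlam.
have c2 : 0 < 1 - c ^+ 2 by rewrite subr_gt0 expr_lt1 // ltW.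
have D0 : 0 < D.
  have : 0 < (1 - c) ^+ 2 by rewrite exprn_gt0 // subr_gt0.
  have : c * cos th <= c * 1 by rewrite ler_pM2l // cos_le1.
  rewrite /D; lra.
rewrite ltr_pdivrMr // in hlam.
rewrite -(ltr_pM2l D0) mulrCA mulr_sumr [X in _ < _ * X]mulr_sumr.
have -> : \sum_(l < L) D * (eigv l * \sum_(m < L) corr rho l m ^+ 2 * eigv m) =
  (1 - c ^+ 2) * \sum_(l < L) eigv l ^+ 2.
  by rewrite mulr_sumr; apply: eq_bigr => l _; rewrite mulrCA eigv_eigen; ring.
rewrite -mulr_sumr mulrA ltr_pM2r //.
rewrite lt_neqAle sumr_ge0 ?andbT; last by move=> l _; exact: sqr_ge0.
rewrite eq_sym psumr_neq0; last by move=> l _; exact: sqr_ge0.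
apply/hasP; exists (Ordinal hL); first exact: mem_index_enum.
by rewrite /= exprn_gt0 // eigv_gt0.
Qed.

End Eigenvector.
End Spectrum.

(** * Graphs and estimators *)

Section Enumeration.
Variables (R : realType) (H : finType) (K : eqType) (ch : K -> channel R H).
Variables (T : finType) (acc : T -> K -> bool) (flip : K -> T -> T).
Hypothesis flipK : forall k, involutive (flip k).
Hypothesis acc_flip : forall k t k', acc (flip k t) k' = acc t k' (+) (k == k').

(** Tables may have entries outside [s]: the factor is the number of tables with prescribed outcomes
    on [s], and [T] stays fixed in the induction. Toggling entry [k] pairs the tables. *)
Lemma sum_obs s (F : (H -> R) -> R) w : uniq s ->
  \sum_t F (fun x => w x * \prod_(k <- s) bern (prob (ch k) x) (acc t k)) =
  #|T|%:R * 2^-1 ^+ size s * obs ch s F w.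
Proof.
elim: s w => [|k s ih] w /=.
  move=> _; rewrite (eq_bigr (fun=> F w)); last first.
    by move=> t _; congr F; apply/funext => x; rewrite big_nil mulr1.
  by rewrite sumr_const expr0 mulr1 mulr_natl.
move=> /andP[ks us].
pose G b t := F (fun x => (w x * bern (prob (ch k) x) b) *
  \prod_(j <- s) bern (prob (ch j) x) (acc t j)).
have GE b t : G b (flip k t) = G b t.
  congr F; apply/funext => x; congr (_ * _); rewrite big_seq [RHS]big_seq.
  apply: eq_bigr => j js; rewrite acc_flip.
  by case: eqP => [E|]; [move: ks; rewrite E js | rewrite addbF].
have SG : \sum_t F (fun x => w x * \prod_(j <- k :: s) bern (prob (ch j) x) (acc t j)) =
    \sum_t G (acc t k) t.
  by apply: eq_bigr => t _; congr F; apply/funext => x; rewrite big_cons mulrA.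
have SGN : \sum_t G (acc t k) t = \sum_t G (~~ acc t k) t.
  rewrite (reindex_inj (inv_inj (flipK k))); apply: eq_bigr => t _.
  by rewrite GE acc_flip eqxx addbT.
have S2 : \sum_t G (acc t k) t + \sum_t G (acc t k) t = \sum_t G true t + \sum_t G false t.
  rewrite {2}SGN -!big_split; apply: eq_bigr => t _ /=.
  by case: (acc t k) => //=; rewrite addrC.
rewrite SG; apply: (@mulfI _ 2) => //; rewrite mulr_natl mulr2n S2 /split exprS.
by rewrite /G !ih //; field.
Qed.

End Enumeration.

Section Graphs.
Variables (R : realType) (n L : nat) (rho : R) (a b : 'I_L -> R).
Let p l := avg_degree (a l) (b l) / n%:R.
Let d l := (a l - b l) / (2 * n%:R).
Local Notation K := ('I_L * edge n)%type.

Definition edge_code (k : K) : code n L := inl ((val k.2).1, (val k.2).2, k.1).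
Definition graph_flip (k : K) (G : multigraph n L) : multigraph n L :=
  [ffun l => [ffun e => G l e (+) (k == (l, e))]].

Lemma graph_flipK k : involutive (graph_flip k).
Proof. by move=> G; apply/ffunP => l; apply/ffunP => e; rewrite !ffunE -addbA addbb addbF. Qed.

Lemma edge_code_perm : perm_eq [seq edge_code k | k <- enum {: K}] (edges L (enum 'I_n)).
Proof.
apply: uniq_perm.
- rewrite map_inj_uniq ?enum_uniq // => -[l e] [l' e'] [] e1 e2 ->.
  by congr pair; apply: val_inj; rewrite /= [val e]surjective_pairing [val e']surjective_pairing e1 e2.
- exact/edges_uniq/enum_uniq.
move=> c; apply/mapP/idP => [[[l e] _ ->]|hc].
  by rewrite mem_edges !mem_enum; exact: (valP e).
have [[[i j] l] E] := edges_inl hc; move: hc; rewrite E mem_edges => /and3P[_ _ ij].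
by exists (l, Sub (i, j) ij : edge n); rewrite ?mem_enum.
Qed.

Lemma dyn_sbmE (hn : (0 < n)%N) (X : labels n L) (G : multigraph n L) :
  dyn_sbm rho a b X G = prior rho X * \prod_(k <- enum {: K})
     bern (prob (ch p d (fun=> 0) (edge_code k)) X) (G k.1 k.2).
Proof.
rewrite /dyn_sbm /prior; congr (_ * _); rewrite big_enum pair_big /=.
apply: eq_bigr => -[l e] _ /=; congr bern.
rewrite /prob /p /d /sigma /sgn /avg_degree /=.
have n0 : n%:R != 0 :> R by rewrite pnatr_eq0 -lt0n.
case: (X (val e).1 l); case: (X (val e).2 l) => /=; rewrite ?expr0 ?expr1; field; exact: n0.
Qed.

(** The bridge from iterated splits to the model; the factor of [sum_obs] is 1 since every graph
    entry is an edge channel. [side] is arbitrary because edge channels ignore it. *)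
Lemma sum_graphs (hn : (0 < n)%N) (F : (labels n L -> R) -> R) side :
  \sum_G F (fun X => dyn_sbm rho a b X G) =
  obs (ch p d side) (edges L (enum 'I_n)) F (@prior R n L rho).
Proof.
have -> : obs (ch p d side) (edges L (enum 'I_n)) F = obs (fun k => ch p d (fun=> 0) (edge_code k)) (enum {: K}) F.
  rewrite -(obs_perm _ _ edge_code_perm).
  by elim: (enum _) => //= k s ->.
have := sum_obs (fun k => ch p d (fun=> 0) (edge_code k)) (acc := fun (G : multigraph n L) k => G k.1 k.2)
  graph_flipK _ F (@prior R n L rho) (enum_uniq {: K}).
rewrite -cardE => h.
transitivity (\sum_(t : multigraph n L) F (fun x => prior rho x *
   \prod_(k <- enum {: K}) bern (prob (ch p d (fun=> 0) (edge_code k)) x) (t k.1 k.2))).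
  by apply: eq_bigr => G _; congr F; apply/funext => X; rewrite dyn_sbmE.
rewrite h; last first.
  by move=> [l e] G [l' e']; rewrite !ffunE /= .
rewrite card_ffun card_ffun card_bool card_prod card_ord -expnM mulnC natrX -exprMn divff // expr1n mul1r //.
Qed.

Definition best_estimate (l : 'I_L) (G : multigraph n L) : {ffun 'I_n -> bool} :=
  [arg max_(y > [ffun=> false] : {ffun 'I_n -> bool}) \sum_X dyn_sbm rho a b X G * `|overlap R y X l|]%O.

Lemma best_estimateP l G (y : {ffun 'I_n -> bool}) :
  \sum_X dyn_sbm rho a b X G * `|overlap R y X l| <=
  \sum_X dyn_sbm rho a b X G * `|overlap R (best_estimate l G) X l|.
Proof. by rewrite /best_estimate; case: arg_maxP => // z _; apply. Qed.

Lemma overlapE (l : 'I_L) (X Y : labels n L) :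
  overlap R [ffun i => Y i l] X l = n%:R^-1 * \sum_i sigma R i l Y * sigma R i l X.
Proof. by rewrite /overlap; congr (_ * _); apply: eq_bigr => i _; rewrite ffunE. Qed.

Lemma overlap_le1 (l : 'I_L) (X Y : labels n L) : (0 < n)%N -> `|overlap R [ffun i => Y i l] X l| <= 1.
Proof.
move=> hn; rewrite overlapE normrM ger0_norm ?invr_ge0 // mulrC ler_pdivrMr ?ltr0n // mul1r.
apply: le_trans (ler_norm_sum _ _ _) _.
rewrite -[X in _ <= X%:R]card_ord -sumr_const; apply: ler_sum => i _.
by rewrite normrM mulr_ile1 // sigma_norm.
Qed.

(* A label vector drawn from the posterior overlaps with the truth as two independent
   posterior samples do. *)
Lemma best_estimate_ge (hn : (0 < n)%N) (l : 'I_L) (G : multigraph n L) :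
  (forall X, 0 <= dyn_sbm rho a b X G) ->
  n%:R ^- 2 * \sum_i \sum_j post2 (fun x => sigma R i l x * sigma R j l x) (fun X => dyn_sbm rho a b X G)
  <= \sum_X dyn_sbm rho a b X G * `|overlap R (best_estimate l G) X l|.
Proof.
move=> w0; set w := fun X => dyn_sbm rho a b X G.
set M := (X in _ <= X).
have M0 : 0 <= M by apply: sumr_ge0 => X _; apply: mulr_ge0; [exact: w0 | exact: normr_ge0].
have := mass_ge0 (w := w) w0; rewrite le_eqVlt => /orP[/eqP h|S0].
  by rewrite big1 ?mulr0 // => i _; rewrite big1 // => j _; rewrite /post2 -h invr0 mulr0.
rewrite /post2; under eq_bigr => i _ do rewrite -mulr_suml.
rewrite -mulr_suml mulrA ler_pdivrMr // replica_sum mulr_sumr [M * _]mulrC mulr_suml.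
apply: ler_sum => Y _.
apply: le_trans (ler_wpM2l (w0 Y) (best_estimateP l G [ffun i => Y i l])).
rewrite mulr_sumr mulr_sumr; apply: ler_sum => X _.
have -> : n%:R ^- 2 * (w Y * w X * (\sum_i sigma R i l Y * sigma R i l X) ^+ 2) =
  w Y * (w X * overlap R [ffun i => Y i l] X l ^+ 2).
  by rewrite overlapE exprMn -exprVn; ring.
apply: ler_wpM2l; first exact: w0.
apply: ler_wpM2l; first exact: w0.
(* An overlap of modulus at most 1 dominates its square. *)
rewrite -real_normK ?num_real // expr2; apply: ler_piMl => //; exact: overlap_le1.
Qed.

End Graphs.

(** * Bounds for large graphs *)

Section Margin.
Variable R : realType.

(** Lower bound for the normalised weighted overlaps when [kap], 1/N and the distance of N [esnr]
    from lambda are all replaced by one parameter [t]; [l0] stands for L. *)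
Definition margin (lambda l0 Q P s t : R) : R :=
  (1 - t) ^+ 2 / 4 * (lambda - t) ^+ 2 * Q - (lambda + t) * P / 4
  - (lambda + t) ^+ 3 * s ^+ 3 / 2
  - 8 * ((lambda + t) * l0) * (2 * t + (lambda + t) * l0 * t)
  - 8 * ((lambda + t) * s) * (2 * t + (lambda + t) * s * t).

Lemma margin_pos (lambda l0 Q P s : R) : 0 < lambda -> 0 < margin lambda l0 Q P s 0 ->
  exists t, [/\ 0 < t, t <= 1 / 2, t <= lambda / 2 & 0 < margin lambda l0 Q P s t].
Proof.
move=> lam0 h0.
pose p : {poly R} := (1 - 'X) ^+ 2 * (lambda%:P - 'X) ^+ 2 * (Q / 4)%:P - (lambda%:P + 'X) * (P / 4)%:P
  - (lambda%:P + 'X) ^+ 3 * (s ^+ 3 / 2)%:P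
  - (lambda%:P + 'X) * (8 * l0)%:P * (2%:P * 'X + (lambda%:P + 'X) * l0%:P * 'X)
  - (lambda%:P + 'X) * (8 * s)%:P * (2%:P * 'X + (lambda%:P + 'X) * s%:P * 'X).
have pE t : margin lambda l0 Q P s t = p.[t].
  by rewrite /p !(hornerD, hornerN, hornerM, hornerX, hornerC, horner_exp) /margin; field.
rewrite pE in h0.
have /cvgr_gt /(_ _ h0) := @continuous_horner R p 0.
move=> /nbhs_ballP[e /= e0 he].
exists (Num.min (e / 2) (Num.min (1 / 2) (lambda / 2))).
have t0 : 0 < Num.min (e / 2) (Num.min (1 / 2) (lambda / 2)) by rewrite !lt_min !divr_gt0.
split=> //.
- by rewrite !ge_min lexx orbT.
- by rewrite !ge_min lexx !orbT.
rewrite pE; apply: he; rewrite /ball /= sub0r normrN gtr0_norm //.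
by rewrite gt_min; apply/orP; left; lra.
Qed.

End Margin.

Section FiniteSize.
Variables (R : realType) (n L : nat) (rho : R).
Hypotheses (hrho : 0 < rho < 1 / 2) (hL : (0 < L)%N).
Variables (p d : 'I_L -> R) (lambda t : R) (q : 'I_L -> R).
Hypotheses (t0 : 0 < t) (t1 : t <= 1 / 2) (tl : t <= lambda / 2) (lam0 : 0 < lambda).
Hypothesis hq : forall l, 0 <= q l <= 1.
Hypothesis hp : forall l, 0 < p l < 1.
Hypothesis hd : forall l, `|d l| <= t * (p l * (1 - p l)).
Hypothesis he : forall l, esnr p d l <= t ^+ 2 / 4.
Variable U : seq 'I_n.
Local Notation N := ((size U)%:R : R).
Hypothesis hN : 1 <= t * N.
Hypothesis hy : forall l, `|esnr p d l * N - lambda| <= t.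

Let side l := Num.sqrt (esnr p d l * q l) / 2.
Let Q := \sum_l q l * \sum_m corr rho l m ^+ 2 * q m.
Let P := \sum_l q l ^+ 2.
Let s := \sum_l q l.

Let kap0 : 0 <= t <= 1 / 2. Proof. by rewrite ltW. Qed.
Let q0 l : 0 <= q l. Proof. by case/andP: (hq l). Qed.
Let e0 l : 0 <= esnr p d l. Proof. exact: esnr_ge0. Qed.

Lemma ssnr_side l : ssnr side l = esnr p d l * q l.
Proof.
rewrite /ssnr /side; set z := esnr p d l * q l.
have z0 : 0 <= z by exact: mulr_ge0.
by rewrite expr_div_n sqr_sqrtr //; field.
Qed.

Lemma side_le l : `|side l| <= t / 4.
Proof.
have z0 : 0 <= esnr p d l * q l by exact: mulr_ge0.
rewrite /side ger0_norm ?divr_ge0 ?sqrtr_ge0 //.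
(* This is where t^2/4 in [he] comes from: the root is at most t/2, and [side] halves it to the
   required t/4. *)
have h : Num.sqrt (esnr p d l * q l) <= Num.sqrt ((t / 2) ^+ 2).
  apply: ler_wsqrtr; apply: le_trans (_ : esnr p d l <= _).
    by apply: ler_piMr => //; case/andP: (hq l).
  by apply: le_trans (he l) _; rewrite expr_div_n; lra.
have t2 : 0 <= t / 2 by rewrite divr_ge0 // ltW.
rewrite sqrtr_sqr (ger0_norm t2) in h; lra.
Qed.

Let N0 : 0 < N.
Proof.
have h1 := hN; have h2 := t0; rewrite lt_neqAle ler0n andbT; apply/negP => /eqP E.
by move: h1; rewrite -E mulr0; lra.
Qed.

Local Notation po := (pair_overlap rho p d side (edges L U)).

Lemma margin_le : margin lambda L%:R Q P s t <=
  \sum_l (esnr p d l * N) / 4 * ((\sum_(i <- U) \sum_(j <- U) po l i j) / N ^+ 2).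
Proof.
have := overlap_sum_ge hrho hL kap0 hp hd side_le ssnr_side U.
have Nn := N0; have ht0 := t0; have ht1 := t1; have htl := tl; have hl0 := lam0; have hN1 := hN.
pose y l := esnr p d l * N.
have y1 l : lambda - t <= y l by have := hy l; rewrite ler_norml => /andP[? ?]; rewrite /y; lra.
have y2 l : y l <= lambda + t by have := hy l; rewrite ler_norml => /andP[? ?]; rewrite /y; lra.
have lt0 : 0 <= lambda - t by lra.
have y0 l : 0 <= y l by exact: le_trans (y1 l).
have L0 : 0 <= L%:R :> R by [].
have s0 : 0 <= s by exact: sumr_ge0.
set T := \sum_l esnr p d l; set S := \sum_l ssnr side l.
set C := \sum_l ssnr side l * csnr rho side l; set X := \sum_l esnr p d l * q l ^+ 2 / 4.
set W := \sum_l esnr p d l / 4 * _ => h.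
have -> : \sum_l esnr p d l * N / 4 * ((\sum_(i <- U) \sum_(j <- U) po l i j) / N ^+ 2) = W / N.
  rewrite mulr_suml; apply: eq_bigr => l _.
  move: (\sum_(i <- U) _) => z; field; lra.
rewrite ler_pdivlMr // mulrC.
have NT : N * T = \sum_l y l by rewrite mulr_sumr; apply: eq_bigr => l _; rewrite mulrC.
have NS : N * S = \sum_l y l * q l.
  by rewrite mulr_sumr; apply: eq_bigr => l _; rewrite ssnr_side /y; ring.
have NX : N * X = (\sum_l y l * q l ^+ 2) / 4.
  by rewrite mulr_sumr mulr_suml; apply: eq_bigr => l _; rewrite /y; ring.
have NC : N ^+ 2 * C = \sum_l (y l * q l) * \sum_m corr rho l m ^+ 2 * (y m * q m).
  rewrite mulr_sumr; apply: eq_bigr => l _.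
  have -> : \sum_m corr rho l m ^+ 2 * (y m * q m) = N * csnr rho side l.
    by rewrite mulr_sumr; apply: eq_bigr => m _; rewrite ssnr_side /y; ring.
  by rewrite ssnr_side /y; ring.
have T0 : 0 <= N * T by rewrite NT sumr_ge0.
have S0 : 0 <= N * S by rewrite NS sumr_ge0 // => l _; rewrite mulr_ge0.
have bT : N * T <= (lambda + t) * L%:R.
  rewrite NT (_ : _ * L%:R = \sum_(l < L) (lambda + t)); first exact: ler_sum.
  by rewrite sumr_const card_ord mulr_natr.
have bS : N * S <= (lambda + t) * s.
  by rewrite NS mulr_sumr; apply: ler_sum => l _; exact: ler_wpM2r.
have bX : N * X <= (lambda + t) * P / 4.
  rewrite NX; apply: ler_wpM2r; first by rewrite invr_ge0.
  by rewrite mulr_sumr; apply: ler_sum => l _; apply: ler_wpM2r; [exact: sqr_ge0 | exact: y2].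
have bC : (lambda - t) ^+ 2 * Q <= N ^+ 2 * C.
  rewrite NC mulr_sumr; apply: ler_sum => l _.
  have -> : (lambda - t) ^+ 2 * (q l * \sum_m corr rho l m ^+ 2 * q m) =
     ((lambda - t) * q l) * \sum_m corr rho l m ^+ 2 * ((lambda - t) * q m).
    rewrite expr2 !mulr_sumr; apply: eq_bigr => m _; ring.
  have yq m : (lambda - t) * q m <= y m * q m by exact: ler_wpM2r.
  apply: ler_pM => //; [exact: mulr_ge0 | | ].
    by apply: sumr_ge0 => m _; apply: mulr_ge0; [exact: sqr_ge0 | exact: mulr_ge0].
  by apply: ler_sum => m _; apply: ler_wpM2l; [exact: sqr_ge0 | exact: yq].
have Q0 : 0 <= Q.
  apply: sumr_ge0 => l _; apply: mulr_ge0 => //.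
  by apply: sumr_ge0 => m _; apply: mulr_ge0 => //; exact: sqr_ge0.
pose x := N^-1.
have x0 : 0 <= x by rewrite invr_ge0 ltW.
have xt : x <= t by rewrite /x -[X in X <= _]mul1r ler_pdivrMr.
have Nx : N * x = 1 by rewrite /x divff // gt_eqF.
apply: (@le_trans _ _ (N * (N * ((N - 1) * (1 - t) / 4 * C - X - N ^+ 2 * S ^+ 3 / 2
   - 8 * T * (2 * t + T) - 8 * S * (2 * t + S))))); last first.
  by apply: le_trans h; rewrite le_eqVlt; apply/orP; left; apply/eqP; ring.
apply: ler_wpM2l; first exact: ltW.
have -> : N * ((N - 1) * (1 - t) / 4 * C - X - N ^+ 2 * S ^+ 3 / 2
   - 8 * T * (2 * t + T) - 8 * S * (2 * t + S)) =
  (1 - x) * (1 - t) / 4 * (N ^+ 2 * C) - N * X - (N * S) ^+ 3 / 2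
   - 8 * (N * T) * (2 * t + (N * T) * x) - 8 * (N * S) * (2 * t + (N * S) * x).
  by rewrite /x; field; lra.
have k1 : (1 - t) ^+ 2 / 4 * (lambda - t) ^+ 2 * Q <= (1 - x) * (1 - t) / 4 * (N ^+ 2 * C).
  rewrite -mulrA; apply: ler_pM => //.
  - by rewrite divr_ge0 // sqr_ge0.
  - by rewrite mulr_ge0 // sqr_ge0.
  - rewrite ler_pM2r ?invr_gt0 // expr2; apply: ler_wpM2r; lra.
have k2 z b : 0 <= z -> z <= b -> 8 * z * (2 * t + z * x) <= 8 * b * (2 * t + b * t).
  move=> z0 zb; apply: ler_pM => //; first exact: mulr_ge0.
  - by rewrite addr_ge0 ?mulr_ge0 // ltW.
  - by rewrite ler_pM2l.
  - by rewrite lerD2l; apply: ler_pM.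
have := k2 _ _ T0 bT; have := k2 _ _ S0 bS.
have : (N * S) ^+ 3 <= ((lambda + t) * s) ^+ 3 by apply: lerXn2r => //; rewrite nnegrE; exact: le_trans bS.
rewrite /margin [((lambda + t) * s) ^+ 3]exprMn; lra.
Qed.

Let g := margin lambda L%:R Q P s t.
Hypothesis g0 : 0 < g.

(** Pigeonhole: otherwise the sum in [margin_le] would be at most g/4 < g. The layer found may vary
    with [n] and [U]. *)
Lemma layer_overlap : exists m : 'I_L,
  g / (L%:R * (lambda + t)) * N ^+ 2 <= \sum_(i <- U) \sum_(j <- U) po m i j.
Proof.
have Nn := N0; have ht0 := t0; have hl0 := lam0.
have L0 : 0 < L%:R :> R by rewrite ltr0n.
have lt0 : 0 < lambda + t by lra.
case: (boolP [exists m : 'I_L, g / (L%:R * (lambda + t)) * N ^+ 2 <= \sum_(i <- U) \sum_(j <- U) po m i j]).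
  by move=> /existsP.
rewrite negb_exists => /forallP h.
have := margin_le; rewrite -/g => hg.
suff : \sum_l (esnr p d l * N) / 4 * ((\sum_(i <- U) \sum_(j <- U) po l i j) / N ^+ 2) <= g / 4.
  by have := g0; lra.
have -> : g / 4 = \sum_(l < L) g / L%:R / 4.
  by rewrite sumr_const card_ord -mulr_natr; field; lra.
apply: ler_sum => l _; rewrite mulrAC ler_pM2r ?invr_gt0 //.
have yb : esnr p d l * N <= lambda + t.
  by have := hy l; rewrite ler_norml => /andP[? ?]; lra.
have y0 : 0 <= esnr p d l * N by rewrite mulr_ge0 // ltW.
have hl : (\sum_(i <- U) \sum_(j <- U) po l i j) / N ^+ 2 <= g / (L%:R * (lambda + t)).
  by rewrite ler_pdivrMr ?exprn_gt0 // ltW // ltNge; exact: h.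
apply: le_trans (ler_wpM2l y0 hl) _.
have -> : g / L%:R = (lambda + t) * (g / (L%:R * (lambda + t))) by field; lra.
apply: ler_wpM2r yb.
by apply: divr_ge0; [exact: ltW | apply: mulr_ge0; exact: ltW].
Qed.

(** Uniform in both layers, so the layer supplied by [layer_overlap] need not be known. *)
Lemma corr_ge (l m : 'I_L) : (1 - 2 * rho) ^+ L <= corr rho l m.
Proof.
have /andP[r0 r1] := hrho.
apply: ler_wiXn2l; [lra | lra |].
case: (leqP l m) => [lm|/ltnW lm].
  by rewrite (eqP lm) add0n (leq_trans (leq_subr _ _)) // ltnW.
by rewrite (eqP lm) addn0 (leq_trans (leq_subr _ _)) // ltnW.
Qed.

Lemma overlap_bound (i j : 'I_n) (l : 'I_L) : i != j -> uniq U -> i \notin U -> j \notin U ->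
  (lambda / 2 * ((1 - 2 * rho) ^+ L) ^+ 2 / (lambda + t + 2)) ^+ 3
    * (g / (L%:R * (lambda + t))) ^+ 4
  <= pair_overlap rho p d side (edges L (enum 'I_n)) l i j.
Proof.
move=> ij uU iU jU.
have Nn := N0; have ht0 := t0; have hl0 := lam0; have htl := tl.
have /andP[r0 r1] := hrho.
have L0 : 0 < L%:R :> R by rewrite ltr0n.
have [m hm] := layer_overlap.
have hqg : 0 <= g / (L%:R * (lambda + t)).
  by apply: divr_ge0; [exact: ltW | apply: mulr_ge0; [exact: ltW | lra]].
have [y1 y2] : lambda / 2 <= esnr p d m * N /\ esnr p d m * N <= lambda + t.
  by have := hy m; rewrite ler_norml => /andP[? ?]; split; lra.
have y0 : 0 < esnr p d m * N by lra.
apply: le_trans (overlap_transfer hrho hL kap0 hp hd side_le l ij uU iU jU hqg y0 hm).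
apply: ler_wpM2r; first exact: exprn_ge0.
have rL : 0 <= (1 - 2 * rho) ^+ L by rewrite exprn_ge0 //; lra.
have c2 : ((1 - 2 * rho) ^+ L) ^+ 2 <= corr rho l m ^+ 2.
  by apply: lerXn2r; rewrite ?nnegrE ?corr_ge0 //; exact: corr_ge.
have sq0 := sqr_ge0 ((1 - 2 * rho) ^+ L).
have den : 0 < lambda + t + 2 by lra.
apply: lerXn2r; rewrite ?nnegrE.
- by apply: divr_ge0; [apply: mulr_ge0 => //; lra | lra].
- by apply: divr_ge0; [apply: mulr_ge0; [exact: ltW | exact: sqr_ge0] | lra].
apply: ler_pM; [by apply: mulr_ge0 => //; lra | by rewrite invr_ge0 ltW | |].
  by apply: ler_pM => //; lra.
by rewrite lef_pV2 ?posrE //; lra.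
Qed.

End FiniteSize.

(** * From posterior overlaps to the estimator *)

Section Recovery.
Variables (R : realType) (L : nat) (rho : R).
Hypotheses (hrho : 0 < rho < 1 / 2) (hL : (0 < L)%N).

Lemma dyn_sbm_ge0 n (a b : 'I_L -> R) (X : labels n L) (G : multigraph n L) : (0 < n)%N ->
  (forall l, 0 <= a l <= n%:R) -> (forall l, 0 <= b l <= n%:R) -> 0 <= dyn_sbm rho a b X G.
Proof.
move=> hn ha hb; apply: mulr_ge0; first exact: prior_ge0.
apply: prodr_ge0 => l _; apply: prodr_ge0 => e _.
have n0 : 0 < n%:R :> R by rewrite ltr0n.
have h (z : R) : 0 <= z <= n%:R -> 0 <= bern (z / n%:R) (G l e).
  move=> /andP[z0 zn]; rewrite /bern; case: (G l e); first by rewrite divr_ge0.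
  by rewrite subr_ge0 ler_pdivrMr // mul1r.
by case: ifP => _; apply: h.
Qed.

Lemma expectation_ge n (a b : 'I_L -> R) (side : 'I_L -> R) (l : 'I_L) (c : R) : (0 < n)%N ->
  (forall l, 0 <= a l <= n%:R) -> (forall l, 0 <= b l <= n%:R) -> c <= 1 ->
  (forall i j : 'I_n, i != j -> c <= pair_overlap rho
     (fun l => avg_degree (a l) (b l) / n%:R) (fun l => (a l - b l) / (2 * n%:R)) side
     (edges L (enum 'I_n)) l i j) ->
  c <= dyn_sbm_expectation rho a b
         (fun (X : labels n L) G => `|overlap R (best_estimate rho a b l G) X l|).
Proof.
move=> hn ha hb c1 hc.
have n0 : 0 < n%:R :> R by rewrite ltr0n.
rewrite /dyn_sbm_expectation exchange_big /=.
apply: (@le_trans _ _ (\sum_(G : multigraph n L) n%:R ^- 2 * \sum_i \sum_j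
   post2 (fun x => sigma R i l x * sigma R j l x) (fun X => dyn_sbm rho a b X G))); last first.
  by apply: ler_sum => G _; apply: best_estimate_ge => // X; exact: dyn_sbm_ge0.
rewrite -mulr_sumr exchange_big /=.
under eq_bigr => i _.
  rewrite exchange_big /=.
  under eq_bigr => j _ do rewrite (sum_graphs rho a b hn _ side).
  over.
rewrite mulrC ler_pdivlMr ?exprn_gt0 //.
have -> : c * n%:R ^+ 2 = \sum_(i < n) \sum_(j < n) c.
  by rewrite !sumr_const !card_ord -mulrnA mulnn -natrX mulr_natr.
apply: ler_sum => i _; apply: ler_sum => j _.
have [->|ij] := eqVneq i j; last exact: hc.
by rewrite -/(pair_overlap _ _ _ _ _ _ _ _) pair_overlap_diag.
Qed.

End Recovery.

Section Limits.
Variable R : realType.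

Lemma limn_einf_gt0 (u : nat -> R) (c : R) : 0 < c ->
  (\forall n \near \oo, c <= u n) -> (0 < limn_einf (fun n => (u n)%:E))%E.
Proof.
move=> c0 [n0 _ h]; apply: (@lt_le_trans _ _ c%:E); first by rewrite lte_fin.
rewrite limn_einf_lim; apply: lime_ge; first exact: is_cvg_einfs.
exists n0 => // n n0n; apply: le_ereal_inf_tmp => _ [k /= nk <-].
by rewrite lee_fin; apply: h; exact: leq_trans n0n nk.
Qed.

Lemma layer_min_cvg (L : nat) (hL : (0 < L)%N) (f : nat -> 'I_L -> R) (M : R) :
  layer_min hL (f n) @[n --> \oo] --> +oo -> \forall n \near \oo, forall l, M <= f n l.
Proof.
move=> /cvgryPge /(_ M); apply: filterS => n h l; apply: le_trans h _.
exact: bigmin_le.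
Qed.

End Limits.

Section SignalToNoise.
Variables (R : realType) (n : nat) (a b : R).
Hypothesis hn : (0 < n)%N.
Let deg := avg_degree a b.
Let var := deg * (1 - deg / n%:R).
Hypotheses (hdeg : 0 < deg) (hvar : 0 < var).

Lemma bias01 : 0 < deg / n%:R < 1.
Proof.
have n0 : 0 < n%:R :> R by rewrite ltr0n.
rewrite divr_gt0 //=; move: hvar; rewrite /var pmulr_rgt0 // subr_gt0 //.
Qed.

Lemma strength_snr :
  ((a - b) / (2 * n%:R)) ^+ 2 / (deg / n%:R * (1 - deg / n%:R)) = snr n a b / n%:R.
Proof.
have n0 : n%:R != 0 :> R by rewrite pnatr_eq0 -lt0n.
have d0 : deg != 0 by rewrite gt_eqF.
have v0 : 1 - deg / n%:R != 0.
  by have /andP[_ h] := bias01; rewrite subr_eq0 gt_eqF.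
have v1 : n%:R - deg != 0.
  apply: contraNneq v0 => /eqP; rewrite subr_eq0 => /eqP E.
  by rewrite -E divff // subrr.
rewrite /snr -/deg; field.
by rewrite n0 d0 v1.
Qed.

(** The squared tilt is (snr/n)(var/n), so relative to var/n the tilt is the square root of snr/var,
    small once var is large. *)
Lemma tilt_le (t : R) : 0 <= t -> snr n a b <= t ^+ 2 * var ->
  `|(a - b) / (2 * n%:R)| <= t * (deg / n%:R * (1 - deg / n%:R)).
Proof.
move=> t0 h.
have n0 : 0 < n%:R :> R by rewrite ltr0n.
have V : deg / n%:R * (1 - deg / n%:R) = var / n%:R by rewrite /var mulrAC.
have V0 : 0 < var / n%:R by rewrite divr_gt0.
have tV : 0 <= t * (var / n%:R) by apply: mulr_ge0 => //; exact: ltW.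
rewrite V -(@ler_pXn2r _ 2) ?nnegrE //.
rewrite real_normK ?num_real //.
have := strength_snr; rewrite V => /(canRL (mulfVK (lt0r_neq0 V0))) ->.
have -> : (t * (var / n%:R)) ^+ 2 = (t ^+ 2 * var) / n%:R * (var / n%:R) by ring.
by apply: ler_wpM2r; [exact: ltW | apply: ler_wpM2r => //; rewrite invr_ge0 ltW].
Qed.

End SignalToNoise.

Theorem proposition2p5 (R : realType) (L : nat) (hL : (0 < L)%N) (rho : R)
    (a b : nat -> 'I_L -> R) (lambdas : 'I_L -> R) (lambda : R)
    (hrho : 0 < rho < 1 / 2)
    (ha : forall (n : nat) (l : 'I_L), (0 < n)%N -> 0 <= a n l <= n%:R)
    (hb : forall (n : nat) (l : 'I_L), (0 < n)%N -> 0 <= b n l <= n%:R)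
    (hlambdas : forall l : 'I_L,
       snr n (a n l) (b n l) @[n --> \oo] --> lambdas l)
    (hlambda : forall l : 'I_L, lambdas l = lambda)
    (hd : layer_min hL (fun l => avg_degree (a n l) (b n l))
            @[n --> \oo] --> +oo)
    (hvar : layer_min hL (fun l => avg_degree (a n l) (b n l)
                            * (1 - avg_degree (a n l) (b n l) / n%:R))
            @[n --> \oo] --> +oo) :
  exists theta : R,
    is_theta_star L rho theta /\
    (dyn_threshold rho theta < lambda ->
     forall l : 'I_L, weakly_recoverable rho a b l).
Proof.
have [th [hstar thA hth]] := theta_star_exists hrho hL.
exists th; split=> // hlam l.
have th0 : 0 < th by case: hstar => /andP[].
pose v (k : 'I_L) := eigv L th k.
have v0 k : 0 < v k by exact: (eigv_gt0 hrho hL th0 thA).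
have v1 k : v k <= 1 by exact: cos_le1.
have := eigv_supercritical hrho hL th0 thA hth hlam.
pose P1 := \sum_(k < L) v k ^+ 2.
pose Q1 := \sum_(k < L) v k * \sum_(m < L) corr rho k m ^+ 2 * v m.
pose s1 := \sum_(k < L) v k.
rewrite -/P1 -/Q1 => hsup.
have P10 : 0 <= P1 by apply: sumr_ge0 => k _; exact: sqr_ge0.
have s10 : 0 <= s1 by apply: sumr_ge0 => k _; exact: ltW.
have Q10 : 0 <= Q1.
  apply: sumr_ge0 => k _; apply: mulr_ge0; first exact: ltW.
  by apply: sumr_ge0 => m _; apply: mulr_ge0; [exact: sqr_ge0 | exact: ltW].
have lam0 : 0 < lambda.
  rewrite ltNge; apply/negP => hl; have := le_lt_trans P10 hsup.
  by rewrite ltNge mulr_le0_ge0.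
(* At q = eps v and t = 0 the margin is eps^2 (A - eps B): A is the supercritical gain, B the cubic
   loss. *)
pose A := lambda / 4 * (lambda * Q1 - P1).
pose B := lambda ^+ 3 * s1 ^+ 3 / 2.
have A0 : 0 < A by rewrite mulr_gt0 ?divr_gt0 // subr_gt0.
have B0 : 0 <= B by rewrite divr_ge0 // mulr_ge0 ?exprn_ge0 // ltW.
pose eps := A / (A + B + 1).
have D0 : 0 < A + B + 1 by lra.
have eps0 : 0 < eps by rewrite divr_gt0.
have eps1 : eps <= 1 by rewrite ler_pdivrMr //; lra.
have epsB : eps * B < A.
  rewrite mulrAC ltr_pdivrMr // ltr_pM2l //; lra.
pose q k := eps * v k.
pose Q := \sum_k q k * \sum_m corr rho k m ^+ 2 * q m.
pose P := \sum_k q k ^+ 2.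
pose s := \sum_k q k.
have QE : Q = eps ^+ 2 * Q1.
  rewrite mulr_sumr; apply: eq_bigr => k _; rewrite /q expr2 !mulr_sumr.
  by apply: eq_bigr => m _; ring.
have PE : P = eps ^+ 2 * P1 by rewrite mulr_sumr; apply: eq_bigr => k _; rewrite exprMn.
have sE : s = eps * s1 by rewrite mulr_sumr.
have m0 : 0 < margin lambda L%:R Q P s 0.
  have -> : margin lambda L%:R Q P s 0 = eps ^+ 2 * (A - eps * B).
    by rewrite /margin QE PE sE /A /B; field.
  by rewrite mulr_gt0 ?exprn_gt0 // subr_gt0.
have [t [t0 t1 tl mt]] := margin_pos lam0 m0.
have q01 k : 0 <= q k <= 1.
  by rewrite /q mulr_ge0 ?(ltW eps0) ?(ltW (v0 k)) //= mulr_ile1 // ltW.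
(* The minimum with 1 covers the diagonal pairs, whose overlap is 1. *)
pose c : R := Num.min 1 ((lambda / 2 * ((1 - 2 * rho) ^+ L) ^+ 2 / (lambda + t + 2)) ^+ 3
    * (margin lambda L%:R Q P s t / (L%:R * (lambda + t))) ^+ 4).
have c0 : 0 < c.
  have /andP[r0 r1] := hrho.
  rewrite lt_min ltr01 /=; apply: mulr_gt0; apply: exprn_gt0.
    apply: divr_gt0; last by lra.
    by apply: mulr_gt0; [lra | do 2!apply: exprn_gt0; lra].
  by apply: divr_gt0 => //; apply: mulr_gt0; [rewrite ltr0n | lra].
exists (fun n => best_estimate rho (a n) (b n) l).
apply: (limn_einf_gt0 c0).
have hsnr : \forall n \near \oo, forall k : 'I_L, `|lambda - snr n (a n k) (b n k)| <= t / 2.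
  apply: filter_forall => k.
  have /cvgr_dist_le /(_ (t / 2)) h := hlambdas k.
  by rewrite hlambda in h; apply: h; rewrite divr_gt0.
have hdeg := layer_min_cvg 1 hd.
have hV := layer_min_cvg ((lambda + 1) / t ^+ 2) hvar.
(* In order, the summands secure esnr <= t^2/4, the loss 2 snr/n <= t/2 and 1 <= t (n - 2), the
   final 2 paying for the two removed vertices. *)
pose M := 4 * (lambda + 1) / t ^+ 2 + 4 * (lambda + 1) / t + 1 / t + 2.
have hbig := @nbhs_infty_ger R M.
near=> n.
have hM : M <= n%:R by near: n.
have hs : forall k : 'I_L, `|lambda - snr n (a n k) (b n k)| <= t / 2 by near: n.
have hdg : forall k : 'I_L, 1 <= avg_degree (a n k) (b n k) by near: n.
have hvr : forall k : 'I_L, (lambda + 1) / t ^+ 2 <=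
   avg_degree (a n k) (b n k) * (1 - avg_degree (a n k) (b n k) / n%:R) by near: n.
have i1 : 0 < 4 * (lambda + 1) / t ^+ 2 by rewrite divr_gt0 ?exprn_gt0 // mulr_gt0 //; lra.
have i2 : 0 < 4 * (lambda + 1) / t by rewrite divr_gt0 // mulr_gt0 //; lra.
have i3 : 0 < 1 / t by rewrite divr_gt0.
have n2 : 2 < n%:R :> R by move: hM; rewrite /M; lra.
have hn : (0 < n)%N by rewrite -(ltr0n R); lra.
have n0 : 0 < n%:R :> R by rewrite ltr0n.
have snr1 k : snr n (a n k) (b n k) <= lambda + t / 2.
  by have := hs k; rewrite ler_norml => /andP[? ?]; lra.
have snr2 k : lambda - t / 2 <= snr n (a n k) (b n k).
  by have := hs k; rewrite ler_norml => /andP[? ?]; lra.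
have V0 k : 0 < avg_degree (a n k) (b n k) * (1 - avg_degree (a n k) (b n k) / n%:R).
  by apply: lt_le_trans (hvr k); rewrite divr_gt0 ?exprn_gt0 //; lra.
have dg0 k : 0 < avg_degree (a n k) (b n k) by apply: lt_le_trans (hdg k).
pose p k := avg_degree (a n k) (b n k) / n%:R.
pose d k := (a n k - b n k) / (2 * n%:R).
have hp k : 0 < p k < 1 by exact: bias01.
have esE k : esnr p d k = snr n (a n k) (b n k) / n%:R by exact: strength_snr.
have htilt k : `|d k| <= t * (p k * (1 - p k)).
  apply: tilt_le => //; first exact: ltW.
  have := hvr k; rewrite ler_pdivrMr ?exprn_gt0 // mulrC; have := snr1 k; lra.
have hes k : esnr p d k <= t ^+ 2 / 4.
  rewrite esE ler_pdivrMr //.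
  have : 4 * (lambda + 1) / t ^+ 2 <= n%:R by move: hM; rewrite /M; lra.
  by rewrite ler_pdivrMr ?exprn_gt0 //; have := snr1 k; lra.
apply: (@expectation_ge _ _ _ hrho hL _ _ _ (fun k => Num.sqrt (esnr p d k * q k) / 2)) => //.
- by move=> k; exact: ha.
- by move=> k; exact: hb.
- by rewrite ge_min lexx.
move=> i j ij; apply: le_trans (_ : _ <= _) _; first by rewrite /c ge_min; apply/orP; right; exact: lexx.
(* [U] changes with the pair, and so may the layer found in it; the bound obtained does not. *)
pose U := enum (~: [set i; j])%SET.
have sU : size U = (n - 2)%N by rewrite -cardE cardsCs finset.setCK cards2 ij card_ord.
have n2' : (2 <= n)%N by rewrite -(ler_nat R) ltW.
have sUR : (size U)%:R = n%:R - 2 :> R by rewrite sU natrB.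
apply: (@overlap_bound _ _ _ _ hrho hL _ _ _ _ _ _ _ _ _ _ _ _ _ U) => //.
- rewrite sUR; have : 1 / t <= n%:R - 2 by move: hM; rewrite /M; lra.
  by rewrite ler_pdivrMr // mulrC.
- move=> k; rewrite sUR esE.
  have -> : snr n (a n k) (b n k) / n%:R * (n%:R - 2) =
     snr n (a n k) (b n k) - 2 * snr n (a n k) (b n k) / n%:R by field; lra.
  have z0 : 0 <= 2 * snr n (a n k) (b n k) / n%:R.
    by rewrite divr_ge0 // mulr_ge0 //; have := snr2 k; lra.
  have z1 : 2 * snr n (a n k) (b n k) / n%:R <= t / 2.
    rewrite ler_pdivrMr //.
    have : 4 * (lambda + 1) / t <= n%:R by move: hM; rewrite /M; lra.
    by rewrite ler_pdivrMr //; have := snr1 k; lra.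
  by have := snr1 k; have := snr2 k; rewrite ler_norml => h1 h2; apply/andP; split; lra.
- exact: enum_uniq.
- by rewrite mem_enum !inE eqxx.
- by rewrite mem_enum !inE eqxx orbT.
Unshelve. all: by end_near.
Qed.
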